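(* Fix an integer $k \ge 2$. For any $\epsilon, K, C > 0$, there exist $n_0, \delta, \tau > 0$ such that the following holds. Let $n \ge n_0$ be an integer, $p > 0$, and let $G$ be an $n$-vertex graph such that $\mathbf{1}_G \le K p \nu$ pointwise, for some function $\nu : V(G) \times V(G) \to [0,\infty)$ satisfying $$\|\nu\|_{S^{2k}} \le C \qquad\text{and}\qquad \|\nu - 1\|_{\square} \le \tau.$$ If $G$ contains at most $\delta p^{2k+1} n^{2k+1}$ copies of $C_{2k+1}$, then $G$ can be made $\{C_3, C_5, \ldots, C_{2k+1}\}$-free by removing at most $\epsilon p n^2$ edges.
   Context: Graphs are finite, unweighted, undirected and simple. $\mathbf{1}_G(x,y)=1$ if $\{x,y\}$ is an edge of $G$ and $0$ otherwise. $C_m$ is the cycle of length $m$; the number of copies of $C_m$ in $G$ is the number of subgraphs of $G$ isomorphic to $C_m$; a graph is $\mathcal{F}$-free if it contains no subgraph isomorphic to a member of $\mathcal{F}$. $V(G)$ is equipped with the uniform probability measure. For $f : V(G)\times V(G)\to\mathbf{C}$ with $n=|V(G)|$, $\|f\|_{S^q}$ ($1\le q<\infty$) is the $\ell^q$ norm of the singular values of the $n\times n$ matrix with $(x,y)$ entry $f(x,y)/n$, and the cut norm is $\|f\|_\square := \sup_{A,B\subset V(G)} \left| \frac{1}{n^2}\sum_{x\in A, y\in B} f(x,y)\right|$. *)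

(* Defs.v *)
From HB Require Import structures.
From mathcomp Require Import all_boot all_order all_algebra.
From mathcomp Require Import reals exp.
From mathcomp Require Import sesquilinear spectral complex.

Set Implicit Arguments.
Unset Strict Implicit.
Unset Printing Implicit Defensive.

Import Order.TTheory GRing.Theory Num.Theory.

Local Open Scope ring_scope.
Local Open Scope sesquilinear_scope.

Record sgraph := SGraph {
  vertex :> finType;
  adj : rel vertex;
  adj_sym : symmetric adj;
  adj_irr : irreflexive adj }.

Definition edges (G : sgraph) : {set {set G}} :=
  [set [set u.1; u.2] | u : G * G & adj u.1 u.2].

Section Cycle.
Variable m : nat.

(* [ordS i] is i + 1 mod m.  This is the cycle of length m only for m >= 3. *)
Definition cycle_rel : rel 'I_m :=
  fun i j => (i != j) && ((j == ordS i) || (i == ordS j)).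

Lemma cycle_rel_sym : symmetric cycle_rel.
Proof. by move=> i j; rewrite /cycle_rel eq_sym orbC. Qed.

Lemma cycle_rel_irr : irreflexive cycle_rel.
Proof. by move=> i; rewrite /cycle_rel eqxx. Qed.

Definition Cycle : sgraph := SGraph cycle_rel_sym cycle_rel_irr.
End Cycle.

(* A subgraph is given by its vertex set and its edge set. *)
Definition is_subgraph (G : sgraph) (S : {set G} * {set {set G}}) : bool :=
  (S.2 \subset edges G) && [forall e in S.2, e \subset S.1].

Definition iso_subgraph (H G : sgraph) (S : {set G} * {set {set G}}) : bool :=
  [exists f : {ffun H -> G},
    [&& injectiveb f,
        f @: [set: H] == S.1 &
        [set f @: (e : {set H}) | e in edges H] == S.2]].

Definition copies (H G : sgraph) : {set {set G} * {set {set G}}} :=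
  [set S | is_subgraph S && iso_subgraph H S].

Definition is_free (H G : sgraph) : bool := copies H G == set0.

Section DeleteEdges.
Variables (G : sgraph) (D : {set {set G}}).

Definition del_rel : rel G := fun x y => adj x y && ([set x; y] \notin D).

Lemma del_rel_sym : symmetric del_rel.
Proof. by move=> x y; rewrite /del_rel adj_sym setUC. Qed.

Lemma del_rel_irr : irreflexive del_rel.
Proof. by move=> x; rewrite /del_rel adj_irr. Qed.

Definition del_edges : sgraph := SGraph del_rel_sym del_rel_irr.
End DeleteEdges.

Section Norms.
Variable R : realType.

(* [spectral_diag B] lists, with multiplicity, the eigenvalues of the normal
   matrix B; here B = A^* A, whose eigenvalues are real and nonnegative. *)
Definition singular_value n (A : 'M[R[i]]_n) (j : 'I_n) : R :=
  Num.sqrt (complex.Re (spectral_diag (A ^t* *m A) 0 j)).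

Variable T : finType.

(* [enum_val] identifies 'I_#|T| with T. *)
Definition kernel_mx (f : T -> T -> R[i]) : 'M[R[i]]_#|T| :=
  \matrix_(i, j) (f (enum_val i) (enum_val j) / #|T|%:R).

Definition schatten_norm (q : R) (f : T -> T -> R[i]) : R :=
  (\sum_(j < #|T|) singular_value (kernel_mx f) j `^ q) `^ q^-1.

(* The supremum is over a finite set of nonnegative reals. *)
Definition cut_norm (f : T -> T -> R[i]) : R :=
  \big[Num.max/0]_(AB : {set T} * {set T})
    complex.Re `| (#|T|%:R ^+ 2)^-1 *
                  \sum_(x in AB.1) \sum_(y in AB.2) f x y |.

End Norms.

(* Main.v *)
Require Import Defs.
From mathcomp Require Import all_boot all_order all_algebra.
From mathcomp Require Import reals exp complex.
From mathcomp Require Import sesquilinear spectral.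
From mathcomp Require Import zify ring lra.

(* Let A = 1_G / (K p n), an entrywise lower bound of the matrix of nu.  The cut
   norm hypothesis bounds the sums of A over rectangles, so deleting the few
   vertices of large degree makes all row sums of A at most 2, while the
   Schatten hypothesis bounds tr (A ^ 2k).  An iterated energy increment gives
   partitions c1 and c2, c2 refining c1, such that averaging A over the cells of
   c2 gives a kernel E2 with entries at most 2 / n, close to A in cut norm at a
   scale depending on c1, and close in L^2 to the average E1 over the cells of
   c1.  Delete the edges lying in pairs of cells of c1 where E1 is small or where
   E2 - E1 is not small in mean square.  A closed walk of odd length at most
   2k+1 that survives extends to a closed walk of length exactly 2k+1.  Around
   its cells, E2 has many closed (2k+1)-walks, and hence so does A by a one-sided
   counting argument.  Restricting to disjoint subsets of these cells makes the
   walks injective, so they are copies of C_{2k+1}: more than the hypothesis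
   allows. *)

Set Implicit Arguments.
Unset Strict Implicit.
Unset Printing Implicit Defensive.

Import Order.TTheory GRing.Theory Num.Theory.

Local Open Scope ring_scope.
Local Open Scope complex_scope.

(** * One-sided counting *)

Section Counting.
Variables (R : realFieldType) (n : nat).
Implicit Types (A G H P Q U V M : 'M[R]_n) (X Y : {set 'I_n}).

(** A count inside cells of relative size [b] has the order of a power of [b], whereas a partition
    achieving cut precision eta may have cells far smaller than eta. One partition therefore cannot
    both locate a walk and control the error. Here [c1] locates it, with cells of relative size at
    least [b1], and [c2] carries a cut precision [kap b1] fine enough for counts at scale [b1].
    Closeness in L^2 carries a lower bound on E1 over to E2 at most points of a pair of cells.

    The exponent 2k comes from counting: when one of the 2k+1 factors is replaced, the others form
    two products of k factors, and the sum of the squared entries of [A ^+ k] is tr (A ^ 2k).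
    Truncating the two products at L / n leaves a cut error L ^ 2 t and a truncation error of order
    1 / L, so L is fixed first and the cut precision after it.

    The scaling gives the constant kernel 1 the entries 1 / n, and p reappears only when traces are
    turned back into copies and edges. *)

Definition lemx A B := forall x y, A x y <= B x y.

Definition rect H X Y := \sum_(x in X) \sum_(y in Y) H x y.

Lemma weighted_sum_ge (a c : 'I_n -> R) :
  (forall x, 0 <= a x <= 1) ->
  \sum_(x in [set x | c x < 0]) c x <= \sum_x a x * c x.
Proof.
move=> ha; rewrite big_mkcond; apply: ler_sum => x _; rewrite inE.
have /andP[a0 a1] := ha x; case: ltP => cx; last exact: mulr_ge0.
by nra.
Qed.

(* A bilinear form on the cube is minimised at a vertex. *)
Lemma rect_weighted_ge H (t : R) (a b : 'I_n -> R) :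
  (forall X Y, - t <= rect H X Y) ->
  (forall x, 0 <= a x <= 1) -> (forall x, 0 <= b x <= 1) ->
  - t <= \sum_x \sum_y a x * H x y * b y.
Proof.
move=> hH ha hb.
have -> : \sum_x \sum_y a x * H x y * b y = \sum_x a x * \sum_y b y * H x y.
  apply: eq_bigr => x _; rewrite mulr_sumr; apply: eq_bigr => y _; ring.
apply: le_trans (weighted_sum_ge _ ha).
set X := [set x | _]; rewrite exchange_big /=.
have -> : \sum_j \sum_(i in X) b j * H i j = \sum_j b j * \sum_(i in X) H i j.
  by apply: eq_bigr => j _; rewrite mulr_sumr.
apply: le_trans (weighted_sum_ge _ hb).
by rewrite exchange_big /=; apply: hH.
Qed.

(** Truncation at [T] changes only values above [T], where [p] is at most [p ^+ 2 / T]. *)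
Lemma subr_min_le (p g T : R) : 0 < T -> 0 <= p <= g -> p - Num.min p T <= g ^+ 2 / T.
Proof.
move=> T0 /andP[p0 pg]; rewrite ler_pdivlMr //.
by case: (leP p T) => h; nra.
Qed.

Lemma mxtrace_mul3 U P Q :
  \tr (U *m (P *m Q)) = \sum_w \sum_x \sum_y U x y * P y w * Q w x.
Proof.
rewrite /mxtrace exchange_big; apply: eq_bigr => x _; rewrite mxE.
rewrite exchange_big; apply: eq_bigr => y _; rewrite mxE mulr_sumr.
by apply: eq_bigr => w _; rewrite mulrA.
Qed.

(* Only a lower bound is possible: a dense spot on few vertices can raise the
   number of cycles without being seen by the cut norm.  Truncating the entries
   of [P] and [Q] at [L / n] can only lower the left-hand trace, and costs
   little in the right-hand one because [V] has bounded entries. *)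
Lemma mxtrace_replace_ge U V P Q G (t L D B : R) :
  (0 < n)%N -> 0 < L -> 0 <= D ->
  lemx 0 U -> lemx 0 V -> lemx V (const_mx (2 / n%:R)) ->
  lemx 0 P -> lemx P G -> lemx 0 Q -> lemx Q G ->
  (forall x, \sum_y G x y <= D) -> (forall y, \sum_x G x y <= D) ->
  \sum_x \sum_y G x y ^+ 2 <= B ->
  (forall X Y, - (t * n%:R) <= rect (U - V) X Y) ->
  \tr (V *m (P *m Q)) - (L ^+ 2 * t + 4 * D * B / L) <= \tr (U *m (P *m Q)).
Proof.
move=> n0 L0 D0 hU hV hV2 hP hPG hQ hQG hr hc hB hcut.
have nR : 0 < n%:R :> R by rewrite ltr0n.
pose T := L / n%:R; have T0 : 0 < T by rewrite divr_gt0.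
have e0 M x y : lemx 0 M -> 0 <= M x y by move/(_ x y); rewrite mxE.
have Ggt0 x y : 0 <= G x y by apply: le_trans (hPG x y); apply: e0.
(* Truncation can only lower the term of [U]. For [V] the loss is split as PQ - pq = (P - p) Q + p
   (Q - q), with [V] at most 2 / n. *)
have pt w x y : (U - V) x y * Num.min (P y w) T * Num.min (Q w x) T
    - (2 / n%:R) * (G y w ^+ 2 / T * G w x) - (2 / n%:R) * (G y w * (G w x ^+ 2 / T))
    <= U x y * P y w * Q w x - V x y * P y w * Q w x.
  have U0 := e0 _ x y hU; have V0 := e0 _ x y hV.
  have V2 := hV2 x y; rewrite mxE in V2.
  have P0 := e0 _ y w hP; have Q0 := e0 _ w x hQ.
  have PG := hPG y w; have QG := hQG w x.
  have dP := subr_min_le T0 (introT andP (conj P0 PG)).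
  have dQ := subr_min_le T0 (introT andP (conj Q0 QG)).
  have PT : 0 <= Num.min (P y w) T <= P y w by rewrite ge_min lexx le_min P0 ltW.
  have QT : 0 <= Num.min (Q w x) T <= Q w x by rewrite ge_min lexx le_min Q0 ltW.
  rewrite !mxE.
  move: (Num.min (P y w) T) (Num.min (Q w x) T) PT QT dP dQ => p q /andP[p0 pP] /andP[q0 qQ] dP dQ.
  have i1 : U x y * p * q <= U x y * P y w * Q w x.
    by rewrite -!mulrA ler_wpM2l // ler_pM.
  have i2 : V x y * ((P y w - p) * Q w x) <= 2 / n%:R * (G y w ^+ 2 / T * G w x).
    apply: ler_pM => //; first by rewrite mulr_ge0 // subr_ge0.
    by apply: ler_pM => //; rewrite subr_ge0.
  have i3 : V x y * (p * (Q w x - q)) <= 2 / n%:R * (G y w * (G w x ^+ 2 / T)).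
    apply: ler_pM => //; first by rewrite mulr_ge0 // subr_ge0.
    by apply: ler_pM => //; [rewrite subr_ge0 | exact: le_trans PG].
  lra.
(* For fixed [w] the truncated entries divided by [T] are weights in [0, 1], so the cut bound
   applies with a factor [T ^+ 2]. Over the n values of [w] this adds up to n T^2 t n = L^2 t. *)
have s1 : - (L ^+ 2 * t) <=
    \sum_w \sum_x \sum_y (U - V) x y * Num.min (P y w) T * Num.min (Q w x) T.
  have -> : - (L ^+ 2 * t) = \sum_(w < n) - (T ^+ 2 * (t * n%:R)).
    rewrite sumr_const card_ord -mulr_natr /T; field.
    by rewrite gt_eqF.
  apply: ler_sum => w _.
  have := @rect_weighted_ge (U - V) (t * n%:R) (fun x => Num.min (Q w x) T / T)
     (fun y => Num.min (P y w) T / T) hcut.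
  have h1 M x y : lemx 0 M -> 0 <= Num.min (M x y) T / T <= 1.
    move=> hM; apply/andP; split; last by rewrite ler_pdivrMr // mul1r ge_min lexx orbT.
    by apply: divr_ge0; rewrite ?le_min ?e0 // ltW.
  move/(_ (fun x => h1 Q w x hQ) (fun y => h1 P y w hP)).
  move/(ler_wpM2l (ltW (mulr_gt0 T0 T0))); rewrite mulrN -expr2 => /le_trans; apply.
  rewrite mulr_sumr; apply: ler_sum => x _; rewrite mulr_sumr; apply: ler_sum => y _.
  rewrite le_eqVlt; apply/orP; left; apply/eqP; field.
  by rewrite gt_eqF.
have s2 : \sum_w \sum_x \sum_y (2 / n%:R) * (G y w ^+ 2 / T * G w x) <= 2 * D * B / L.
  have -> : 2 * D * B / L = 2 / n%:R * (B / T * D) by rewrite /T; field; rewrite !gt_eqF.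
  rewrite (eq_bigr (fun w => 2 / n%:R * ((\sum_y G y w ^+ 2) / T * \sum_x G w x))); last first.
    move=> w _; rewrite !mulr_sumr; apply: eq_bigr => x _.
    by rewrite -mulr_sumr mulr_suml mulr_suml.
  rewrite -mulr_sumr ler_wpM2l ?divr_ge0 //.
  apply: le_trans (_ : \sum_w (\sum_y G y w ^+ 2) / T * D <= _).
    apply: ler_sum => w _; rewrite ler_wpM2l //.
    by rewrite divr_ge0 ?sumr_ge0 ?ltW // => ? _; rewrite sqr_ge0.
  rewrite -mulr_suml ler_wpM2r // -mulr_suml ler_wpM2r ?invr_ge0 ?(ltW T0) //.
  by rewrite exchange_big.
have s3 : \sum_w \sum_x \sum_y (2 / n%:R) * (G y w * (G w x ^+ 2 / T)) <= 2 * D * B / L.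
  have -> : 2 * D * B / L = 2 / n%:R * (D * (B / T)) by rewrite /T; field; rewrite !gt_eqF.
  rewrite (eq_bigr (fun w => 2 / n%:R * ((\sum_y G y w) * ((\sum_x G w x ^+ 2) / T)))); last first.
    move=> w _; rewrite (mulr_suml _ _ _ T^-1) !mulr_sumr; apply: eq_bigr => x _.
    by rewrite -mulr_sumr mulr_suml.
  rewrite -mulr_sumr ler_wpM2l ?divr_ge0 //.
  apply: le_trans (_ : \sum_w D * ((\sum_x G w x ^+ 2) / T) <= _).
    apply: ler_sum => w _; rewrite ler_wpM2r //.
    by rewrite divr_ge0 ?sumr_ge0 ?ltW // => ? _; rewrite sqr_ge0.
  by rewrite -mulr_sumr ler_wpM2l // -mulr_suml ler_wpM2r // invr_ge0 ltW.
have tot : \sum_w \sum_x \sum_y ((U - V) x y * Num.min (P y w) T * Num.min (Q w x) T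
    - (2 / n%:R) * (G y w ^+ 2 / T * G w x) - (2 / n%:R) * (G y w * (G w x ^+ 2 / T)))
   <= \tr (U *m (P *m Q)) - \tr (V *m (P *m Q)).
  rewrite !mxtrace_mul3 -sumrB; apply: ler_sum => w _.
  rewrite -sumrB; apply: ler_sum => x _.
  by rewrite -sumrB; apply: ler_sum => y _; apply: pt.
have sp F1 F2 F3 : \sum_(w < n) \sum_(x < n) \sum_(y < n) (F1 w x y - F2 w x y - F3 w x y : R)
   = \sum_w \sum_x \sum_y F1 w x y - \sum_w \sum_x \sum_y F2 w x y - \sum_w \sum_x \sum_y F3 w x y.
  rewrite -!sumrB; apply: eq_bigr => w _; rewrite -!sumrB; apply: eq_bigr => x _.
  by rewrite -!sumrB.
rewrite sp in tot.
have e4 : 4 * D * B / L = 2 * D * B / L + 2 * D * B / L by field; rewrite gt_eqF.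
lra.
Qed.

Lemma lemx_prod (s : seq 'M[R]_n) G : lemx 0 G ->
  (forall M, M \in s -> lemx 0 M /\ lemx M G) ->
  lemx 0 (\prod_(M <- s) M) /\ lemx (\prod_(M <- s) M) (G ^+ size s).
Proof.
move=> G0; elim: s => [|M s IH] hs.
  rewrite big_nil expr0; split=> x y; last by [].
  by rewrite [X in _ <= X]mxE mxE; case: (x == y).
rewrite big_cons exprS.
have [|h0 hG] := IH; first by move=> N Ns; apply: hs; rewrite inE Ns orbT.
have [M0 MG] := hs M (mem_head _ _).
have e0 N x y : lemx 0 N -> 0 <= N x y by move/(_ x y); rewrite mxE.
split=> x y; rewrite [X in _ <= X]mxE [X in X <= _]mxE.
  by apply: sumr_ge0 => z _; rewrite mulr_ge0 ?e0.
by apply: ler_sum => z _; apply: ler_pM; rewrite ?e0 //.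
Qed.

Lemma mulmx_row_sum_le A H (a b : R) : lemx 0 A -> 0 <= b ->
  (forall x, \sum_y A x y <= a) -> (forall x, \sum_y H x y <= b) ->
  forall x, \sum_y (A *m H) x y <= a * b.
Proof.
move=> A0 b0 hA hH x.
have -> : \sum_y (A *m H) x y = \sum_z A x z * \sum_y H z y.
  under eq_bigr => y _ do rewrite mxE.
  by rewrite exchange_big; apply: eq_bigr => z _; rewrite mulr_sumr.
apply: le_trans (_ : \sum_z A x z * b <= _).
  by apply: ler_sum => z _; rewrite ler_wpM2l //; have := A0 x z; rewrite mxE.
by rewrite -mulr_suml ler_wpM2r.
Qed.

Lemma lemx0_exp A k : lemx 0 A -> lemx 0 (A ^+ k).
Proof.
move=> A0; have [] := @lemx_prod (nseq k A) A A0; last by rewrite big_nseq -Monoid.iteropE.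
by move=> M; rewrite mem_nseq => /andP[_ /eqP ->]; split=> // x y; apply: lexx.
Qed.

Lemma expmx_row_sum_le A (a : R) k : lemx 0 A -> 0 <= a ->
  (forall x, \sum_y A x y <= a) -> forall x, \sum_y (A ^+ k) x y <= a ^+ k.
Proof.
move=> A0 a0 hA; elim: k => [|k IH] x.
  rewrite !expr0 (bigD1 x) //= big1 ?addr0 ?mxE ?eqxx // => y yx.
  by rewrite mxE eq_sym (negbTE yx).
by rewrite !exprS; apply: mulmx_row_sum_le => //; apply: exprn_ge0.
Qed.

Lemma trmx_exp A k : (A ^+ k)^T = A^T ^+ k.
Proof. by elim: k => [|k IH]; rewrite ?expr0 ?trmx1 // exprS exprSr trmx_mul IH. Qed.

(** [A] plus the constant matrix dominates both [A] and the averaged kernels, so its powers bound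
    mixed products of the two. In (A + 2/n)(A^k + 8^k/n) each of the three terms other than A^(k+1)
    is at most 2 * 8^k / n, because row and column sums of [A] are at most 2. *)
Lemma exp_add_const_le A k : (0 < n)%N -> lemx 0 A -> A^T = A ->
  (forall x, \sum_y A x y <= 2) ->
  lemx ((A + const_mx (2 / n%:R)) ^+ k) (A ^+ k + const_mx (8 ^+ k / n%:R)).
Proof.
move=> n0 A0 AT hA; have nR : 0 < n%:R :> R by rewrite ltr0n.
have e0 N x y : lemx 0 N -> 0 <= N x y by move/(_ x y); rewrite mxE.
elim: k => [|k IH] x y.
  by rewrite !expr0 [X in _ <= X]mxE lerDl mxE divr_ge0 ?expr0 // ltW.
rewrite 3!exprS mxE.
apply: le_trans (_ : \sum_j (A x j * (A ^+ k) j y + A x j * (8 ^+ k / n%:R)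
   + 2 / n%:R * (A ^+ k) j y + 2 / n%:R * (8 ^+ k / n%:R)) <= _).
  apply: ler_sum => z _.
  have := IH z y; rewrite !mxE => h.
  apply: le_trans (ler_wpM2l _ h) _; first by rewrite addr_ge0 ?e0 ?divr_ge0 // ltW.
  by rewrite le_eqVlt; apply/orP; left; apply/eqP; ring.
rewrite !big_split /= [X in _ <= X]mxE mxE -!addrA lerD2l.
rewrite -mulr_suml -mulr_sumr sumr_const card_ord mxE.
have c2 : \sum_j (A ^+ k) j y <= 2 ^+ k.
  rewrite (eq_bigr (fun j => (A ^+ k) y j)); first exact: expmx_row_sum_le.
  by move=> j _; rewrite -{2}AT -trmx_exp mxE.
have p8 : 0 <= 8 ^+ k / n%:R :> R by rewrite divr_ge0 ?exprn_ge0 // ltW.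
apply: le_trans (_ : 2 * (8 ^+ k / n%:R) + (2 / n%:R * 8 ^+ k + 2 / n%:R * 8 ^+ k) <= _).
  apply: lerD; first by rewrite ler_wpM2r.
  apply: lerD; last by rewrite -mulr_natr le_eqVlt; apply/orP; left; apply/eqP; field; rewrite gt_eqF.
  rewrite ler_wpM2l ?divr_ge0 ?(ltW nR) //; apply: le_trans c2 _.
  by apply: lerXn2r; rewrite ?nnegrE // ler_nat.
have -> : 8 * 8 ^+ k / n%:R = 2 * (8 ^+ k / n%:R) + (2 / n%:R * 8 ^+ k + 2 / n%:R * 8 ^+ k) + 2 * (8 ^+ k / n%:R) :> R.
  by field; rewrite gt_eqF.
by rewrite lerDl mulr_ge0.
Qed.

Lemma sum_sqr_exp_add_const A k (B : R) : (0 < n)%N -> lemx 0 A -> A^T = A ->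
  (forall x, \sum_y A x y <= 2) ->
  \sum_x \sum_y (A ^+ k) x y ^+ 2 <= B ->
  \sum_x \sum_y ((A + const_mx (2 / n%:R)) ^+ k) x y ^+ 2 <= 2 * B + 2 * 64 ^+ k.
Proof.
move=> n0 A0 AT hA hB; have nR : 0 < n%:R :> R by rewrite ltr0n.
have e0 N x y : lemx 0 N -> 0 <= N x y by move/(_ x y); rewrite mxE.
have G0 : lemx 0 (A + const_mx (2 / n%:R)).
  by move=> x y; rewrite [X in _ <= X]mxE !mxE addr_ge0 ?e0 // divr_ge0 // ltW.
apply: le_trans (_ : \sum_x \sum_y (2 * (A ^+ k) x y ^+ 2 + 2 * (64 ^+ k / n%:R ^+ 2)) <= _).
  apply: ler_sum => x _; apply: ler_sum => y _.
  have h := exp_add_const_le k n0 A0 AT hA x y; rewrite !mxE in h.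
  have g0 := e0 _ x y (lemx0_exp k G0).
  have a0 := e0 _ x y (lemx0_exp k A0).
  have -> : 64 ^+ k / n%:R ^+ 2 = (8 ^+ k / n%:R) ^+ 2 :> R.
    by rewrite expr_div_n -exprM mulnC exprM; congr (_ ^+ _ / _); ring.
  have p8 : 0 <= 8 ^+ k / n%:R :> R by rewrite divr_ge0 ?exprn_ge0 // ltW.
  move: (8 ^+ k / n%:R : R) p8 h g0 a0 => b b0.
  move: ((A ^+ k) x y) (((A + const_mx (2 / n%:R)) ^+ k) x y) => a g h g0 a0.
  have h2 : g ^+ 2 <= (a + b) ^+ 2 by apply: lerXn2r; rewrite ?nnegrE // addr_ge0.
  apply: le_trans h2 _; have := sqr_ge0 (a - b); nra.
under eq_bigr => x _ do rewrite big_split /= sumr_const card_ord -mulr_sumr.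
rewrite big_split /= sumr_const card_ord -mulr_sumr.
apply: lerD; first by rewrite ler_wpM2l.
rewrite -[X in X <= _]mulr_natr -[_ *+ n in X in X <= _]mulr_natr le_eqVlt; apply/orP; left; apply/eqP; field.
by rewrite gt_eqF.
Qed.

(* Replace the factors one at a time; by cyclicity of the trace the other [2k]
   factors form two products of [k] factors, each entrywise below [G ^+ k]. *)
Lemma mxtrace_prod_replace_ge k A (B t L : R) (U V : nat -> 'M[R]_n) :
  (0 < n)%N -> 0 < L -> lemx 0 A -> A^T = A -> (forall x, \sum_y A x y <= 2) ->
  \sum_x \sum_y (A ^+ k) x y ^+ 2 <= B ->
  (forall i, lemx 0 (U i)) -> (forall i, lemx (U i) A) ->
  (forall i, lemx 0 (V i)) -> (forall i, lemx (V i) (const_mx (2 / n%:R))) ->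
  (forall i X Y, - (t * n%:R) <= rect (U i - V i) X Y) ->
  \tr (\prod_(0 <= i < (2 * k).+1) V i)
    - (2 * k).+1%:R * (L ^+ 2 * t + 4 * 4 ^+ k * (2 * B + 2 * 64 ^+ k) / L)
  <= \tr (\prod_(0 <= i < (2 * k).+1) U i).
Proof.
move=> n0 L0 A0 AT hA hB U0 UA V0 V2 hcut; have nR : 0 < n%:R :> R by rewrite ltr0n.
have e0 N x y : lemx 0 N -> 0 <= N x y by move/(_ x y); rewrite mxE.
set G := A + const_mx (2 / n%:R); set err := L ^+ 2 * t + _.
have J0 x y : 0 <= (const_mx (2 / n%:R) : 'M[R]_n) x y by rewrite mxE divr_ge0 // ltW.
have G0 : lemx 0 G.
  move=> x y; rewrite [X in _ <= X]mxE [X in X <= _]mxE; apply: addr_ge0; [exact: e0 | exact: J0].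
have GT : G^T = G by rewrite /G linearD /= AT trmx_const.
have Grow x : \sum_y G x y <= 4.
  under eq_bigr => y _ do rewrite mxE.
  rewrite big_split /=.
  have -> : 4 = 2 + 2 :> R by ring.
  apply: lerD => //.
  under eq_bigr => y _ do rewrite mxE.
  by rewrite sumr_const card_ord -[X in X <= _]mulr_natr divfK // gt_eqF.
have UG i : lemx (U i) G.
  by move=> x y; rewrite [X in _ <= X]mxE; apply: ler_wpDr; [exact: J0 | exact: UA].
have VG i : lemx (V i) G.
  by move=> x y; rewrite [X in _ <= X]mxE; apply: ler_wpDl; [exact: e0 | exact: V2].
have tr3 (a b c : 'M[R]_n) : \tr (a * (b * c)) = \tr (b *m (c *m a)).
  by rewrite -[a * _]/(a *m (b *m c)) mxtrace_mulC mulmxA.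
(* Hybrids: [V] in the first [j] positions and [U] in the others, so that consecutive hybrids differ
   only in position [j]. *)
pose Z j i := if (i < j)%N then V i else U i.
have Z0 j i : lemx 0 (Z j i) by rewrite /Z; case: ifP.
have ZG j i : lemx (Z j i) G by rewrite /Z; case: ifP.
pose m := (2 * k).+1.
have step j : (j < m)%N ->
  \tr (\prod_(0 <= i < m) Z j.+1 i) - err <= \tr (\prod_(0 <= i < m) Z j i).
  move=> jm.
  (* The factors other than the one in position [j], in cyclic order after it; both hybrids share
     them. *)
  pose s := [seq Z j i | i <- index_iota j.+1 m ++ index_iota 0 j].
  have szs : size s = (2 * k)%N by rewrite size_map size_cat !size_iota /m; lia.
  have dec j' : (j' = j \/ j' = j.+1) ->
    \tr (\prod_(0 <= i < m) Z j' i) = \tr (Z j' j *m (\prod_(M <- take k s) M *m \prod_(M <- drop k s) M)).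
    move=> hj'.
    rewrite -[X in _ *m X]/(_ * _) -big_cat cat_take_drop big_map big_cat /=.
    rewrite (big_cat_nat _ (n := j)) //=; last exact: ltnW.
    rewrite [X in _ * X](big_ltn) //.
    rewrite tr3; congr (\tr (_ *m (_ *m _))).
      apply: eq_big_nat => i ?; rewrite /Z; case: hj' => -> //.
      by have -> : (i < j.+1)%N = (i < j)%N by lia.
    apply: eq_big_nat => i ?; rewrite /Z; case: hj' => -> //.
    by have -> : (i < j.+1)%N = (i < j)%N by lia.
  rewrite (dec j (or_introl erefl)) (dec j.+1 (or_intror erefl)).
  have -> : Z j.+1 j = V j by rewrite /Z ltnSn.
  have -> : Z j j = U j by rewrite /Z ltnn.
  have hs M : M \in s -> lemx 0 M /\ lemx M G by case/mapP => i _ ->.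
  have [|P0 PG] := @lemx_prod (take k s) G G0; first by move=> M /mem_take; apply: hs.
  have [|Q0 QG] := @lemx_prod (drop k s) G G0; first by move=> M /mem_drop; apply: hs.
  have sz1 : size (take k s) = k by rewrite size_take szs; case: ifP; lia.
  have sz2 : size (drop k s) = k by rewrite size_drop szs; lia.
  rewrite sz1 in PG; rewrite sz2 in QG.
  apply: (mxtrace_replace_ge n0 L0 _ (U0 j) (V0 j) (V2 j) P0 PG Q0 QG) => //.
  - exact: exprn_ge0.
  - exact: expmx_row_sum_le.
  - move=> y; rewrite (eq_bigr (fun x => (G ^+ k) y x)); first exact: expmx_row_sum_le.
    by move=> x _; rewrite -{2}GT -trmx_exp mxE.
  - exact: sum_sqr_exp_add_const.
have tele j : (j <= m)%N ->
  \tr (\prod_(0 <= i < m) Z j i) - j%:R * err <= \tr (\prod_(0 <= i < m) Z 0 i).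
  elim: j => [|j IH] jm; first by rewrite mul0r subr0.
  apply: le_trans (IH (ltnW jm)).
  have := step j jm; rewrite -natr1 mulrDl mul1r; lra.
have := tele m (leqnn m).
rewrite (eq_big_nat _ _ (F2 := V)); last by move=> i /andP[_ im]; rewrite /Z im.
by rewrite (eq_big_nat _ _ (F1 := Z 0) (F2 := U)).
Qed.

End Counting.

(** * Strong regularity *)

Section Regularity.
Variables (R : realFieldType) (n : nat).
Implicit Types (A H M : 'M[R]_n) (X Y : {set 'I_n}) (c : 'I_n -> nat).

(** Rectangles are bounded from above only, which is what a kernel inherits from one that dominates
    it. Density 1 means entries 1 / n, hence the main term |X||Y| / n. *)
Definition spread A (t : R) :=
  [/\ lemx 0 A, A^T = A, (forall x, \sum_y A x y <= 2) &
      forall X Y, rect A X Y <= #|X|%:R * #|Y|%:R / n%:R + t * n%:R].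

(** A partition is given by a colouring [c], and a cell is named by one of its points: it is never
    empty, so averages over it make sense. *)
Definition cell c x : {set 'I_n} := [set y | c y == c x].

(** The orthogonal projection onto vectors constant on cells. It is symmetric and idempotent, which
    turns statements on averages into identities between matrix products. *)
Definition avgmx c : 'M[R]_n := \matrix_(x, y) ((c x == c y)%:R / #|cell c x|%:R).

Definition coarse c A := avgmx c *m A *m avgmx c.

Definition energy c A := \sum_x \sum_y coarse c A x y ^+ 2.

(** This replaces a bound on the number of cells: the error [t * n%:R] on a rectangle has to be
    compared with the sizes of cells. *)
Definition big_cells c (b : R) := forall x, b * n%:R <= #|cell c x|%:R.

Definition refines c' c := forall x y, c' x = c' y -> c x = c y.

Definition lowcut c A (eta : R) :=
  forall X Y, - (eta * n%:R) <= rect (A - coarse c A) X Y.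

Lemma mem_cell c x : x \in cell c x.
Proof. by rewrite inE. Qed.

Lemma cell_eq c x y : c x = c y -> cell c x = cell c y.
Proof. by move=> e; apply/setP => z; rewrite !inE e. Qed.

Lemma card_cell_gt0 c x : 0 < #|cell c x|%:R :> R.
Proof. by rewrite ltr0n card_gt0; apply/set0Pn; exists x; apply: mem_cell. Qed.

Lemma avgmx_ge0 c x y : 0 <= avgmx c x y.
Proof. by rewrite mxE divr_ge0. Qed.

Lemma trmx_avgmx c : (avgmx c)^T = avgmx c.
Proof.
apply/matrixP => x y; rewrite !mxE eq_sym.
by case: eqP => [/cell_eq ->|]; rewrite ?mul0r.
Qed.

Lemma sum_avgmx c x (a : 'I_n -> R) :
  \sum_y avgmx c x y * a y = (\sum_(y in cell c x) a y) / #|cell c x|%:R.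
Proof.
rewrite mulr_suml [RHS]big_mkcond; apply: eq_bigr => y _.
by rewrite mxE inE eq_sym; case: eqP; rewrite ?mul1r ?mul0r // mulrC.
Qed.

Lemma sum_avgmx_fix c x (a : 'I_n -> R) :
  (forall y, c y = c x -> a y = a x) -> \sum_y avgmx c x y * a y = a x.
Proof.
move=> ha; rewrite sum_avgmx (eq_bigr (fun _ => a x)); last first.
  by move=> y; rewrite inE => /eqP/ha.
by rewrite sumr_const -[X in X / _]mulr_natr mulfK // gt_eqF // card_cell_gt0.
Qed.

Lemma avgmx_row_sum c x : \sum_y avgmx c x y = 1.
Proof.
by have := @sum_avgmx_fix c x (fun _ => 1) (fun _ _ => erefl); under eq_bigr do rewrite mulr1.
Qed.

Lemma avgmx_mul c' c : refines c' c -> avgmx c' *m avgmx c = avgmx c.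
Proof.
move=> hr; apply/matrixP => x y; rewrite mxE.
apply: (@sum_avgmx_fix c' x (fun z => avgmx c z y)) => z /hr zx.
by rewrite !mxE zx (cell_eq zx).
Qed.

Lemma avgmx_mulr c' c : refines c' c -> avgmx c *m avgmx c' = avgmx c.
Proof. by move=> hr; apply: trmx_inj; rewrite trmx_mul !trmx_avgmx avgmx_mul. Qed.

Lemma rect_mx H X Y :
  rect H X Y = ((\col_i (i \in X)%:R)^T *m (H *m \col_i (i \in Y)%:R)) 0 0.
Proof.
rewrite mxE /rect big_mkcond; apply: eq_bigr => x _; rewrite !mxE.
case: (x \in X); rewrite ?mul0r // mul1r big_mkcond; apply: eq_bigr => y _; rewrite mxE.
by case: (y \in Y); rewrite ?mulr0 ?mulr1.
Qed.

Lemma coarseE c A x y :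
  coarse c A x y = rect A (cell c x) (cell c y) / (#|cell c x|%:R * #|cell c y|%:R).
Proof.
rewrite /coarse -mulmxA mxE sum_avgmx /rect invfM mulrCA [LHS]mulrC; congr (_ * _).
rewrite mulr_suml; apply: eq_bigr => z _.
rewrite mxE -sum_avgmx; apply: eq_bigr => w _.
by rewrite mulrC -[in LHS]trmx_avgmx mxE.
Qed.

Lemma coarse_ge0 c A x y : lemx 0 A -> 0 <= coarse c A x y.
Proof.
move=> A0; rewrite coarseE divr_ge0 ?mulr_ge0 //.
by apply: sumr_ge0 => z _; apply: sumr_ge0 => w _; have := A0 z w; rewrite mxE.
Qed.

Lemma trmx_coarse c A : A^T = A -> (coarse c A)^T = coarse c A.
Proof. by move=> AT; rewrite /coarse !trmx_mul trmx_avgmx AT mulmxA. Qed.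

Lemma coarse_row_sum c A : lemx 0 A -> (forall x, \sum_y A x y <= 2) ->
  forall x, \sum_y coarse c A x y <= 2.
Proof.
move=> A0 hA x; rewrite /coarse -mulmxA -[2]mul1r.
have w0 : lemx 0 (avgmx c) by move=> a b; rewrite mxE avgmx_ge0.
apply: mulmx_row_sum_le => //; first by move=> z; rewrite avgmx_row_sum.
move=> z; rewrite -[2]mulr1; apply: mulmx_row_sum_le => // u; by rewrite avgmx_row_sum.
Qed.

(** Two cells have sizes with product at least [b ^+ 2 * n%:R ^+ 2], hence at least [t * n%:R ^+ 2],
    so the error term of [spread] at most doubles the density bound. *)
Lemma coarse_le c A (t b : R) : (0 < n)%N -> 0 < b -> t <= b ^+ 2 ->
  spread A t -> big_cells c b -> lemx (coarse c A) (const_mx (2 / n%:R)).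
Proof.
move=> n0 b0 tb [A0 _ _ hA] hc x y; rewrite [X in _ <= X]mxE coarseE.
have nR : 0 < n%:R :> R by rewrite ltr0n.
have := hA (cell c x) (cell c y); have := hc x; have := hc y.
have := card_cell_gt0 c x; have := card_cell_gt0 c y.
move: (#|cell c x|%:R : R) (#|cell c y|%:R : R) => p q q0 p0 hq hp h.
rewrite ler_pdivrMr ?mulr_gt0 //; apply: le_trans h _.
have bn : 0 <= b * n%:R by rewrite mulr_ge0 ?ltW.
have pq : b * n%:R * (b * n%:R) <= p * q by apply: ler_pM.
have h1 : t * n%:R <= p * q / n%:R.
  rewrite ler_pdivlMr //; apply: le_trans pq.
  have := ler_wpM2r (ltW (mulr_gt0 nR nR)) tb; rewrite expr2; lra.
have -> : 2 / n%:R * (p * q) = p * q / n%:R + p * q / n%:R by field; rewrite gt_eqF.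
lra.
Qed.

Lemma sum_sqr_trace M : M^T = M -> \sum_x \sum_y M x y ^+ 2 = \tr (M *m M).
Proof.
move=> MT; apply: eq_bigr => x _; rewrite mxE; apply: eq_bigr => y _.
by rewrite -{3}MT mxE expr2.
Qed.

(** [coarse c A] is the orthogonal projection of [coarse c' A], so their inner product, written as a
    trace, is the energy of the coarser one. *)
Lemma energy_pythagoras c' c A : A^T = A -> refines c' c ->
  \sum_x \sum_y (coarse c' A - coarse c A) x y ^+ 2 = energy c' A - energy c A.
Proof.
move=> AT hr; have ET' := trmx_coarse c' AT; have ET := trmx_coarse c AT.
rewrite /energy !sum_sqr_trace //; last by rewrite linearB /= ET ET'.
have hcc : refines c c by [].
have EE : \tr (coarse c A *m coarse c A) = \tr (A *m avgmx c *m A *m avgmx c).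
  by rewrite mxtrace_mulC /coarse !mulmxA -[_ *m avgmx c *m avgmx c]mulmxA avgmx_mul //
     -!mulmxA mxtrace_mulC -!mulmxA avgmx_mul // !mulmxA.
have E'E : \tr (coarse c' A *m coarse c A) = \tr (A *m avgmx c *m A *m avgmx c).
  by rewrite /coarse !mulmxA -[_ *m avgmx c' *m avgmx c]mulmxA avgmx_mul //
     -!mulmxA mxtrace_mulC -!mulmxA avgmx_mulr // !mulmxA.
rewrite mulmxBl !mulmxBr !linearB /= E'E [\tr (coarse c A *m coarse c' A)]mxtrace_mulC E'E EE.
ring.
Qed.

Lemma energy_le4 c A (t b : R) : (0 < n)%N -> 0 < b -> t <= b ^+ 2 ->
  spread A t -> big_cells c b -> energy c A <= 4.
Proof.
move=> n0 b0 tb hA hc; have nR : 0 < n%:R :> R by rewrite ltr0n.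
have -> : 4 = \sum_(x < n) \sum_(y < n) (2 / n%:R) ^+ 2 :> R.
  rewrite !sumr_const !card_ord -[RHS]mulr_natr -[_ *+ n in RHS]mulr_natr; field.
  by rewrite gt_eqF.
apply: ler_sum => x _; apply: ler_sum => y _.
have h := coarse_le n0 b0 tb hA hc x y; rewrite [X in _ <= X]mxE in h.
apply: lerXn2r => //; rewrite nnegrE; first by apply: coarse_ge0; case: hA.
by rewrite divr_ge0 ?(ltW nR).
Qed.

Lemma energy_ge0 c A : 0 <= energy c A.
Proof. by apply: sumr_ge0 => x _; apply: sumr_ge0 => y _; apply: sqr_ge0. Qed.

Lemma rectB H M X Y : rect (H - M) X Y = rect H X Y - rect M X Y.
Proof.
rewrite /rect -sumrB; apply: eq_bigr => x _; rewrite -sumrB; apply: eq_bigr => y _.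
by rewrite !mxE.
Qed.

(** The indicator of a union of cells is fixed by the projection [avgmx c]. *)
Lemma rect_coarse c A X Y :
  (forall x y, c x = c y -> (x \in X) = (y \in X)) ->
  (forall x y, c x = c y -> (x \in Y) = (y \in Y)) ->
  rect (coarse c A) X Y = rect A X Y.
Proof.
have fix_ind Z : (forall x y, c x = c y -> (x \in Z) = (y \in Z)) ->
    avgmx c *m (\col_i (i \in Z)%:R) = \col_i (i \in Z)%:R :> 'cV[R]_n.
  move=> hZ; apply/colP => x; rewrite mxE.
  rewrite (@sum_avgmx_fix c x (fun y => (\col_i (i \in Z)%:R : 'cV[R]_n) y 0)) // => y yx.
  by rewrite !mxE (hZ _ _ yx).
move=> hX hY; rewrite !rect_mx /coarse -!mulmxA fix_ind // !mulmxA.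
by rewrite -{1}[avgmx c]trmx_avgmx -trmx_mul fix_ind.
Qed.

Lemma rect_perturb H X Y X' Y' (b : R) :
  (forall x, \sum_y `|H x y| <= b) -> (forall y, \sum_x `|H x y| <= b) ->
  rect H X' Y' <= rect H X Y + b * (\sum_x ((x \in X) != (x \in X'))%:R)
                + b * (\sum_y ((y \in Y) != (y \in Y'))%:R).
Proof.
move=> hr hc.
have rE Z W : rect H Z W = \sum_x \sum_y (x \in Z)%:R * (y \in W)%:R * H x y.
  rewrite /rect big_mkcond; apply: eq_bigr => x _.
  case: (x \in Z); last by rewrite big1 // => y _; rewrite !mul0r.
  by rewrite big_mkcond; apply: eq_bigr => y _; case: (y \in W); rewrite ?mulr0 ?mul0r // !mul1r.
apply: le_trans (_ : rect H X Y
   + \sum_x ((x \in X) != (x \in X'))%:R * (\sum_y `|H x y|)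
   + \sum_y ((y \in Y) != (y \in Y'))%:R * (\sum_x `|H x y|) <= _); last first.
  rewrite !mulr_sumr; apply: lerD; first apply: lerD => //.
    by apply: ler_sum => x _; rewrite mulrC ler_wpM2r.
  by apply: ler_sum => x _; rewrite mulrC ler_wpM2r.
rewrite !rE; under [X in _ + X]eq_bigr do rewrite mulr_sumr.
under [X in _ + X + _]eq_bigr do rewrite mulr_sumr.
rewrite [X in _ + X]exchange_big -!big_split /=; apply: ler_sum => x _.
rewrite -!big_split /=; apply: ler_sum => y _.
have := ler_norm (H x y); have := ler_norm (- H x y); rewrite normrN.
by case: (x \in X); case: (x \in X'); case: (y \in Y); case: (y \in Y') => /=;
  rewrite ?mul0r ?mul1r ?mulr0 ?add0r ?addr0; lra.
Qed.

Lemma refines_trans c1 c2 c3 : refines c3 c2 -> refines c2 c1 -> refines c3 c1.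
Proof. by move=> h32 h21 x y /h32 /h21. Qed.

Lemma big_cells_le c (b b' : R) : b' <= b -> big_cells c b -> big_cells c b'.
Proof. by move=> bb hc x; apply: le_trans (hc x); rewrite ler_wpM2r. Qed.

(* Cells whose intersection with [X] or with its complement would be too small
   are not split; [X'] is [X] rounded accordingly. *)
Lemma split_cells c (b th : R) X : 0 < b -> 0 < th <= 1 -> big_cells c b ->
  exists c' X', [/\ refines c' c, big_cells c' (th * b),
    (forall x y, c' x = c' y -> (x \in X') = (y \in X')) &
    \sum_x ((x \in X) != (x \in X'))%:R <= th * n%:R].
Proof.
(* [bd] is the size guaranteed to the new cells. Old cells have at least [b * n%:R] points, so [bd]
   is also at most a fraction [th] of each of them, which bounds how many points the rounding
   moves. *)
move=> b0 /andP[t0 t1] hc; pose bd := th * b * n%:R.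
pose s x := #|cell c x :&: X|%:R < bd; pose r x := #|cell c x :\: X|%:R < bd.
pose X' := [set x | ~~ s x && (r x || (x \in X))].
pose c' x := ((c x).*2 + (x \in X'))%N.
have c'E x y : (c' x == c' y) = (c x == c y) && ((x \in X') == (y \in X')).
  by rewrite /c'; case: (x \in X'); case: (y \in X'); apply/eqP/andP => [|[/eqP]]; lia.
have sE x y : c x = c y -> s x = s y by move=> e; rewrite /s (cell_eq e).
have rE x y : c x = c y -> r x = r y by move=> e; rewrite /r (cell_eq e).
have bdle x : bd <= th * #|cell c x|%:R by rewrite /bd -mulrA ler_wpM2l // ltW.
have bdle1 x : bd <= #|cell c x|%:R.
  by apply: le_trans (bdle x) _; rewrite ler_piMl.
exists c', X'; split.
- by move=> x y /eqP; rewrite c'E => /andP[/eqP].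
- move=> x; rewrite -/bd.
  have -> : cell c' x = [set y in cell c x | (y \in X') == (x \in X')].
    by apply/setP => y; rewrite !inE c'E !inE.
  case sx : (s x).
    apply: le_trans (bdle1 x) _; rewrite ler_nat subset_leq_card //.
    by apply/subsetP => y; rewrite !inE => /eqP e; rewrite e eqxx (sE _ _ e) sx.
  case rx : (r x).
    apply: le_trans (bdle1 x) _; rewrite ler_nat subset_leq_card //.
    by apply/subsetP => y; rewrite !inE => /eqP e; rewrite e eqxx (sE _ _ e) sx (rE _ _ e) rx.
  have -> : [set y in cell c x | (y \in X') == (x \in X')] =
      if x \in X then cell c x :&: X else cell c x :\: X.
    apply/setP => y; case: ifP => xX; rewrite !inE sx rx xX /=; case: eqP => //= e; rewrite ?andbF //.
      by rewrite (sE _ _ e) (rE _ _ e) sx rx /= eqb_id.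
    by rewrite (sE _ _ e) (rE _ _ e) sx rx /= andbT eqbF_neg.
  by case: ifP => _; [move: sx | move: rx] => /negbT; rewrite -leNgt.
- by move=> x y /eqP; rewrite c'E => /andP[_ /eqP].
have -> : \sum_x ((x \in X) != (x \in X'))%:R =
    \sum_x \sum_y avgmx c x y * ((y \in X) != (y \in X'))%:R.
  rewrite exchange_big; apply: eq_bigr => y _; rewrite -mulr_suml.
  rewrite (eq_bigr (fun x => avgmx c y x)) ?avgmx_row_sum ?mul1r // => x _.
  by rewrite -[in LHS]trmx_avgmx mxE.
apply: le_trans (_ : \sum_(x < n) th <= _); last by rewrite sumr_const card_ord mulr_natr.
apply: ler_sum => x _; rewrite sum_avgmx ler_pdivrMr ?card_cell_gt0 //.
have cnt (Z : {set _}) : Z \subset cell c x -> #|Z|%:R <= bd ->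
  (forall y, y \in cell c x -> ((y \in X) != (y \in X')) = (y \in Z)) ->
  \sum_(y in cell c x) ((y \in X) != (y \in X'))%:R <= th * #|cell c x|%:R.
  move=> Zs hZ hy; apply: le_trans (bdle x); apply: le_trans hZ.
  rewrite (eq_bigr (fun y => (y \in Z)%:R)); last by move=> y /hy ->.
  rewrite -natr_sum ler_nat -sum1_card big_mkcond [X in (_ <= X)%N]big_mkcond.
  by apply: leq_sum => y _; case: ifP => //; case: (y \in Z).
case sx : (s x).
  apply: (cnt (cell c x :&: X)); rewrite ?subsetIl ?ltW // => y; rewrite !inE => e.
  by rewrite e (sE _ _ (eqP e)) sx /=; case: (y \in X).
case rx : (r x).
  apply: (cnt (cell c x :\: X)); rewrite ?subsetDl ?ltW // => y; rewrite !inE => e.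
  by rewrite e (sE _ _ (eqP e)) sx (rE _ _ (eqP e)) rx /=; case: (y \in X).
apply: (cnt set0); rewrite ?sub0set ?cards0 // ?mulr_ge0 ?(ltW t0) ?(ltW b0) // => y.
by rewrite !inE => e; rewrite (sE _ _ (eqP e)) sx (rE _ _ (eqP e)) rx /= eqxx.
Qed.

(** A rectangle violating [lowcut] is rounded to unions of new cells. Each side moves at most eta n
    / 16 points, and row sums of |A - coarse c A| are at most 4, so the rounding costs at most eta n
    / 2 and half of the deficit survives. On unions of cells averaging changes nothing, and by
    Cauchy-Schwarz the remaining deficit gives an energy gain (eta / 2)^2. *)
Lemma cut_step c A (t b eta : R) : (0 < n)%N -> 0 < b -> 0 < eta <= 1 ->
  spread A t -> big_cells c b -> ~ lowcut c A eta ->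
  exists c', [/\ refines c' c, big_cells c' (b * (eta / 16) ^+ 2) &
    energy c A + eta ^+ 2 / 4 <= energy c' A].
Proof.
move=> n0 b0 /andP[e0 e1] [A0 AT hA _] hc hcut; have nR : 0 < n%:R :> R by rewrite ltr0n.
have /existsP[X /existsP[Y]] :
    [exists X, exists Y, rect (A - coarse c A) X Y < - (eta * n%:R)].
  apply: contra_notT hcut => /existsPn h X Y.
  by have /existsPn/(_ Y) := h X; rewrite -leNgt.
move=> hXY; have th : 0 < eta / 16 <= 1 by apply/andP; split; lra.
have th0 : 0 < eta / 16 by case/andP: th.
have [c1 [X' [ref1 big1 mX dX]]] := split_cells X b0 th hc.
have [c2 [Y' [ref2 big2 mY dY]]] := split_cells Y (mulr_gt0 th0 b0) th big1.
have ref : refines c2 c := refines_trans ref2 ref1.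
exists c2; split=> //; first by move=> x; have := big2 x; congr (_ * _ <= _); ring.
pose H := A - coarse c A.
have HT : H^T = H by rewrite /H linearB /= AT trmx_coarse.
have Hr x : \sum_y `|H x y| <= 4.
  have -> : 4 = 2 + 2 :> R by ring.
  apply: le_trans (lerD (hA x) (coarse_row_sum c A0 hA x)).
  rewrite -big_split; apply: ler_sum => y _.
  have -> : H x y = A x y - coarse c A x y by rewrite /H mxE [X in _ + X]mxE.
  apply: le_trans (ler_normB _ _) _.
  by have a0 := A0 x y; rewrite mxE in a0; rewrite !ger0_norm ?coarse_ge0.
have Hc y : \sum_x `|H x y| <= 4.
  by rewrite (eq_bigr (fun x => `|H y x|)) // => x _; rewrite -[in LHS]HT mxE.
have := rect_perturb X Y X' Y' Hr Hc; rewrite -/H in hXY => hp.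
have mX2 x y : c2 x = c2 y -> (x \in X') = (y \in X') by move/ref2; apply: mX.
have hE : rect H X' Y' = rect (coarse c2 A - coarse c A) X' Y'.
  by rewrite !rectB (rect_coarse A mX2 mY).
rewrite hE in hp.
rewrite -lerBrDl -energy_pythagoras //.
move: (coarse c2 A - coarse c A) hp => M hp.
have hM : rect M X' Y' <= - (eta * n%:R / 2).
  have i1 := ler_wpM2l (ler0n R 4) dX; have i2 := ler_wpM2l (ler0n R 4) dY.
  lra.
(* [(M x y + a) ^ 2 >= 0] on [X' * Y'], with [a = eta / 2n] *)
pose a := eta / (2 * n%:R).
apply: le_trans (_ : \sum_(x in X') \sum_(y in Y') (- (2 * a) * M x y - a ^+ 2) <= _).
  have -> : \sum_(x in X') \sum_(y in Y') (- (2 * a) * M x y - a ^+ 2) =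
     - (2 * a) * rect M X' Y' - #|X'|%:R * #|Y'|%:R * a ^+ 2.
    rewrite /rect mulr_sumr; under eq_bigr do rewrite sumrB -mulr_sumr sumr_const.
    rewrite sumrB sumr_const -[_ *+ #|X'|]mulr_natl -[_ *+ #|Y'|]mulr_natl; ring.
  have a0 : 0 < a by rewrite divr_gt0 ?mulr_gt0.
  have c1n : #|X'|%:R <= n%:R :> R by rewrite ler_nat -[X in (_ <= X)%N]card_ord max_card.
  have c2n : #|Y'|%:R <= n%:R :> R by rewrite ler_nat -[X in (_ <= X)%N]card_ord max_card.
  have i1 : #|X'|%:R * #|Y'|%:R * a ^+ 2 <= n%:R * n%:R * a ^+ 2.
    by rewrite ler_wpM2r ?sqr_ge0 // ler_pM.
  have i2 : a * rect M X' Y' <= - (a * (eta * n%:R / 2)).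
    by rewrite -mulrN ler_wpM2l // ltW.
  have e2 : a * (eta * n%:R / 2) = eta ^+ 2 / 4 by rewrite /a; field; rewrite gt_eqF.
  have e3 : n%:R * n%:R * a ^+ 2 = eta ^+ 2 / 4 by rewrite /a; field; rewrite gt_eqF.
  lra.
rewrite big_mkcond; apply: ler_sum => x _; case: ifP => _; last first.
  by apply: sumr_ge0 => y _; apply: sqr_ge0.
rewrite big_mkcond; apply: ler_sum => y _; case: ifP => _; last exact: sqr_ge0.
have := sqr_ge0 (M x y + a); nra.
Qed.

End Regularity.

(** * Iterating the energy increment *)

Section StrongRegularity.
Variable R : archiRealFieldType.

Lemma energy_refine n (A : 'M[R]_n) c' c : A^T = A -> refines c' c ->
  energy c A <= energy c' A.
Proof.
move=> AT hr; rewrite -subr_ge0 -energy_pythagoras //.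
by apply: sumr_ge0 => x _; apply: sumr_ge0 => y _; apply: sqr_ge0.
Qed.

Lemma lowcut_dec n (A : 'M[R]_n) c eta : lowcut c A eta \/ ~ lowcut c A eta.
Proof.
have [h|h] := boolP [forall X, forall Y, - (eta * n%:R) <= rect (A - coarse c A) X Y].
  by left=> X Y; have /forallP/(_ X)/forallP/(_ Y) := h.
by right=> h'; case/negP: h; apply/forallP => X; apply/forallP => Y; apply: h'.
Qed.

Lemma weak_regularity_iter (m : nat) (b eta : R) n (A : 'M[R]_n) t c :
  0 < b -> 0 < eta <= 1 -> (0 < n)%N -> spread A t -> big_cells c b ->
  exists c', [/\ refines c' c, big_cells c' (b * (eta / 16) ^+ (2 * m)) &
    lowcut c' A eta \/ energy c A + m%:R * (eta ^+ 2 / 4) <= energy c' A].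
Proof.
move=> b0 he n0 hA hc; elim: m => [|m [c' [ref big1 hm]]].
  by exists c; split=> //; [rewrite muln0 expr0 mulr1 | right; rewrite mul0r addr0].
have /andP[e0 e1] := he.
have q0 : 0 < eta / 16 by lra.
have [hl|hl] := lowcut_dec A c' eta.
  exists c'; split=> //; last by left.
  apply: big_cells_le big1; rewrite ler_wpM2l ?(ltW b0) //.
  have -> : (2 * m.+1 = 2 * m + 2)%N by lia.
  rewrite exprD ler_piMr ?exprn_ge0 ?(ltW q0) //; apply: exprn_ile1; lra.
have b1 : 0 < b * (eta / 16) ^+ (2 * m) by rewrite mulr_gt0 // exprn_gt0.
have [c2 [ref2 big2 en2]] := cut_step n0 b1 he hA big1 hl.
exists c2; split; first exact: refines_trans ref2 ref.
  have -> : b * (eta / 16) ^+ (2 * m.+1) = b * (eta / 16) ^+ (2 * m) * (eta / 16) ^+ 2.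
    by rewrite -mulrA -exprD; congr (_ * _ ^+ _); lia.
  exact: big2.
right; case: hm => // hm; rewrite -natr1 mulrDl mul1r; lra.
Qed.

(** The energy stays in [0, 4] and each failure of [lowcut] raises it by [eta ^+ 2 / 4], so [m]
    successive refinements cannot all fail. The resulting [b'] depends only on [b] and [eta]. *)
Lemma weak_regularity (b eta : R) : 0 < b -> 0 < eta <= 1 ->
  exists b', 0 < b' <= b /\ forall n (A : 'M[R]_n) t c,
    (0 < n)%N -> t <= b' ^+ 2 -> spread A t -> big_cells c b ->
    exists c', [/\ refines c' c, big_cells c' b' & lowcut c' A eta].
Proof.
move=> b0 he; have /andP[e0 e1] := he.
have q0 : 0 < eta ^+ 2 / 4 by rewrite divr_gt0 ?exprn_gt0.
pose m := Num.bound (4 / (eta ^+ 2 / 4)).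
have hm : 4 < m%:R * (eta ^+ 2 / 4).
  rewrite -ltr_pdivrMr //; apply: archi_boundP; exact: divr_ge0 (ler0n _ 4) (ltW _).
exists (b * (eta / 16) ^+ (2 * m)); split.
  rewrite mulr_gt0 ?exprn_gt0 ?divr_gt0 //= ler_piMr ?(ltW b0) //.
  by apply: exprn_ile1; lra.
move=> n A t c n0 ht hA hc.
have [c' [ref big1 [hl|hen]]] := weak_regularity_iter m b0 he n0 hA hc; exists c'; split=> //.
have := energy_le4 n0 _ ht hA big1; rewrite mulr_gt0 ?exprn_gt0 ?divr_gt0 // => /(_ isT).
have := energy_ge0 c A; lra.
Qed.

(** The current partition has cells of a known relative size [b], so the precision [kap b] asked of
    its refinement is fixed before [n] and [A]: precision may depend on [c1] while [b'] stays
    uniform. A refinement that gains more than [gam] in energy becomes the current partition. *)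
Lemma strong_regularity_iter (kap : R -> R) (gam : R) (m : nat) (b : R) :
  (forall x, 0 < x -> 0 < kap x <= 1) -> 0 < b ->
  exists b', 0 < b' <= b /\ forall n (A : 'M[R]_n) t c,
    (0 < n)%N -> t <= b' ^+ 2 -> spread A t -> big_cells c b ->
    exists c1 c2 b1,
      [/\ b' <= b1, big_cells c1 b1, refines c2 c1, big_cells c2 b' & lowcut c2 A (kap b1)]
      /\ (energy c2 A <= energy c1 A + gam \/ energy c A + m%:R * gam <= energy c2 A).
Proof.
move=> hk; elim: m b => [|m IH] b b0;
  have [bw [/andP[bw0 bwb] hw]] := weak_regularity b0 (hk b b0).
  exists bw; split=> [|n A t c n0 ht hA hc]; first by rewrite bw0.
  have [c2 [ref big2 hl]] := hw n A t c n0 ht hA hc.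
  exists c, c2, b; split=> //; right; rewrite mul0r addr0.
  by apply: energy_refine => //; case: hA.
have [b' [/andP[b'0 b'w] hb']] := IH bw bw0.
exists b'; split=> [|n A t c n0 ht hA hc]; first by rewrite b'0 (le_trans b'w).
have ht' : t <= bw ^+ 2 by apply: le_trans ht _; apply: lerXn2r; rewrite ?nnegrE // ltW.
have [c2 [ref big2 hl]] := hw n A t c n0 ht' hA hc.
have [hle|hgt] := leP (energy c2 A) (energy c A + gam).
  exists c, c2, b; split; last by left.
  by split=> //; [apply: le_trans bwb | apply: big_cells_le big2].
have [c3 [c4 [b1 [h1 h2]]]] := hb' n A t c2 n0 ht hA big2.
exists c3, c4, b1; split=> //; case: h2 => h2; [by left | right].
rewrite -natr1 mulrDl mul1r; lra.
Qed.

Lemma strong_regularity (kap : R -> R) (gam : R) :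
  (forall x, 0 < x -> 0 < kap x <= 1) -> 0 < gam ->
  exists b', 0 < b' /\ forall n (A : 'M[R]_n) t,
    (0 < n)%N -> t <= b' ^+ 2 -> spread A t ->
    exists c1 c2 b1,
      [/\ b' <= b1, big_cells c1 b1, refines c2 c1, big_cells c2 b' & lowcut c2 A (kap b1)]
      /\ energy c2 A <= energy c1 A + gam.
Proof.
move=> hk g0; pose m := Num.bound (4 / gam).
have hm : 4 < m%:R * gam.
  rewrite -ltr_pdivrMr //; apply: archi_boundP; exact: divr_ge0 (ler0n _ 4) (ltW _).
have [b' [/andP[b'0 b'1] hb']] := @strong_regularity_iter kap gam m 1 hk ltr01.
exists b'; split=> // n A t n0 ht hA.
have big0 : big_cells (fun _ : 'I_n => 0%N) (1 : R).
  move=> x; have -> : cell (fun _ => 0%N) x = [set: 'I_n] by apply/setP => y; rewrite !inE.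
  by rewrite cardsT card_ord mul1r.
have [c1 [c2 [b1 [h1 [h2|h2]]]]] := hb' n A t _ n0 ht hA big0; exists c1, c2, b1; split=> //.
case: h1 => _ _ _ big2 _; have := energy_le4 n0 b'0 ht hA big2.
have := energy_ge0 (fun _ : 'I_n => 0%N) A; lra.
Qed.

End StrongRegularity.

(** * Closed walks and removal for matrices *)

Section Walks.
Variables (R : realFieldType) (n : nat).
Implicit Types (A : 'M[R]_n) (U V : nat -> 'M[R]_n).

Lemma sum_tuple_cons (T : finType) j (F : j.+1.-tuple T -> R) :
  \sum_t F t = \sum_x \sum_(s : j.-tuple T) F [tuple of x :: s].
Proof.
rewrite pair_big (reindex (fun u : T * j.-tuple T => [tuple of u.1 :: u.2])) //.
exists (fun t => (thead t, [tuple of behead t])) => [[x s]|t] _ /=.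
  by congr (_, _); apply: val_inj.
by rewrite -tuple_eta.
Qed.

Lemma mxprod_path U j x y : (\prod_(0 <= i < j.+1) U i) x y =
  \sum_(s : j.-tuple 'I_n) \prod_(i < j.+1)
    U i (nth x (x :: rcons s y) i) (nth x (rcons s y) i).
Proof.
elim: j U x => [|j IH] U x.
  rewrite big_nat1 (big_pred1 [tuple]) => [|t]; last by symmetry; apply/eqP; apply: tuple0.
  by rewrite big_ord_recl big_ord0 mulr1.
rewrite big_nat_recl // mxE sum_tuple_cons; apply: eq_bigr => z _.
rewrite IH mulr_sumr; apply: eq_bigr => s _.
rewrite [RHS]big_ord_recl /=; congr (_ * _).
have hs : size (rcons s y) = j.+1 by rewrite size_rcons size_tuple.
apply: eq_bigr => i _; rewrite /bump /= add1n.
by congr (U _ _ _); apply: set_nth_default; rewrite ?hs ?(leq_trans (ltn_ord i)) //= hs ltnW // ltnS.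
Qed.

Lemma mxtrace_prod U j : \tr (\prod_(0 <= i < j.+1) U i) =
  \sum_(w : {ffun 'I_j.+1 -> 'I_n}) \prod_(i < j.+1) U i (w i) (w (ordS i)).
Proof.
rewrite /mxtrace (eq_bigr _ (fun x _ => mxprod_path U j x x)).
rewrite -(sum_tuple_cons (fun t : j.+1.-tuple 'I_n => \prod_(i < j.+1)
   U i (nth (thead t) (rcons t (thead t)) i) (nth (thead t) (rcons (behead t) (thead t)) i))).
rewrite (reindex (fun w : {ffun 'I_j.+1 -> 'I_n} => [tuple w i | i < j.+1])); last first.
  exists (fun t : j.+1.-tuple _ => [ffun i => tnth t i]) => [w|t] _.
    by apply/ffunP => i; rewrite ffunE tnth_mktuple.
  by apply: eq_from_tnth => i; rewrite tnth_mktuple ffunE.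
apply: eq_bigr => w _; apply: eq_bigr => i _.
set t := mktuple _; have tE l : tnth t l = w l by rewrite tnth_mktuple.
have st : size t = j.+1 by rewrite size_tuple.
congr (U _ _ _).
  by rewrite nth_rcons st ltn_ord -tE (tnth_nth (thead t)).
rewrite nth_rcons size_behead st /= -tE (tnth_nth (thead t)) nth_behead /=.
have := ltn_ord i; rewrite ltnS leq_eqVlt => /orP[/eqP ij|ij]; last first.
  by rewrite ij modn_small.
by rewrite ij ltnn eqxx modnn; apply: (tnth_nth (thead t) t ord0).
Qed.

(** The coordinates of [w] are independent. Fixing [w i = a] and [w i' = b] by indicators absorbed
    into the factors at [i] and [i'] leaves a sum of products, which distributes. *)
Lemma sum_walk_pair m (chi : 'I_m -> 'I_n -> R) (F : 'I_n -> 'I_n -> R) (i i' : 'I_m) :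
  i' != i ->
  \sum_(w : {ffun 'I_m -> 'I_n}) (\prod_l chi l (w l)) * F (w i) (w i') =
  (\sum_a \sum_b chi i a * chi i' b * F a b) * \prod_(l | (l != i) && (l != i')) \sum_x chi l x.
Proof.
move=> ii; have ii2 : (i == i') = false by rewrite eq_sym (negbTE ii).
pose G a b l x := chi l x * ((l == i) ==> (x == a))%:R * ((l == i') ==> (x == b))%:R.
transitivity (\sum_a \sum_b F a b * \sum_(w : {ffun 'I_m -> 'I_n}) \prod_l G a b l (w l)).
  under [RHS]eq_bigr do under eq_bigr do rewrite mulr_sumr.
  under [RHS]eq_bigr do rewrite exchange_big.
  rewrite [RHS]exchange_big; apply: eq_bigr => w _ /=.
  rewrite (bigD1 (w i)) //= (bigD1 (w i')) //= [X in _ + X + _]big1 ?addr0; last first.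
    by move=> b hb; rewrite (bigD1 i') //= /G eqxx /= [_ == b]eq_sym (negbTE hb) !mulr0 mul0r mulr0.
  rewrite [X in _ + X]big1 ?addr0; last first.
    move=> a ha; apply: big1 => b _.
    by rewrite (bigD1 i) //= /G eqxx /= [_ == a]eq_sym (negbTE ha) mulr0 !mul0r mulr0.
  rewrite mulrC; congr (_ * _); apply: eq_bigr => l _; rewrite /G.
  have -> : (l == i) ==> (w l == w i) by apply/implyP => /eqP ->.
  have -> : (l == i') ==> (w l == w i') by apply/implyP => /eqP ->.
  by rewrite !mulr1.
rewrite mulr_suml; apply: eq_bigr => a _; rewrite mulr_suml; apply: eq_bigr => b _.
rewrite -bigA_distr_bigA /= (bigD1 i) //= (bigD1 i') //=.
have -> : \sum_j G a b i j = chi i a.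
  rewrite (bigD1 a) //= big1 ?addr0 => [|x xa]; rewrite /G ?eqxx /= ii2 /= ?mulr1 //.
  by rewrite (negbTE xa) mulr0 ?mul0r.
have -> : \sum_j G a b i' j = chi i' b.
  rewrite (bigD1 b) //= big1 ?addr0 => [|x xb]; rewrite /G ?eqxx /= (negbTE ii) /= ?mulr1 //.
  by rewrite (negbTE xb) mulr0 ?mul0r.
have -> : \prod_(l | (l != i) && (l != i')) \sum_j G a b l j =
    \prod_(l | (l != i) && (l != i')) \sum_x chi l x.
  apply: eq_bigr => l /andP[/negbTE li /negbTE li']; apply: eq_bigr => x _.
  by rewrite /G li li' !mulr1.
ring.
Qed.

(* Union bound over the steps of the walk. *)
Lemma mxtrace_prod_ge j V (X : 'I_j.+1 -> {set 'I_n}) (bad : 'I_j.+1 -> rel 'I_n) (a : R) :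
  (0 < j)%N -> 0 <= a -> (forall i, lemx 0 (V i)) -> (forall i, 0 < #|X i|%:R :> R) ->
  (forall (i : 'I_j.+1) x y, x \in X i -> y \in X (ordS i) -> ~~ bad i x y -> a <= V i x y) ->
  (forall i, \sum_(x in X i) \sum_(y in X (ordS i)) (bad i x y)%:R * (2 * j.+1%:R)
     <= #|X i|%:R * #|X (ordS i)|%:R :> R) ->
  a ^+ j.+1 * (\prod_i #|X i|%:R) / 2 <= \tr (\prod_(0 <= i < j.+1) V i).
Proof.
move=> j0 a0 V0 X0 hgood hbad; rewrite mxtrace_prod.
pose chi i x : R := (x \in X i)%:R.
pose N : R := \prod_i #|X i|%:R.
have chiE i : \sum_x chi i x = #|X i|%:R.
  by rewrite -natr_sum -sum1_card [in RHS]big_mkcond; congr _%:R; apply: eq_bigr => x _; case: ifP.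
(* For a walk inside the sets [X i] the bracket is 1 minus its number of bad steps, hence at most 0
   unless every step is good. Each position is bad for at most a fraction 1 / (2 (j + 1)) of these
   walks, so half of the main term remains. *)
apply: le_trans (_ : \sum_(w : {ffun 'I_j.+1 -> 'I_n}) a ^+ j.+1 * ((\prod_i chi i (w i)) -
    \sum_i (\prod_l chi l (w l)) * (bad i (w i) (w (ordS i)))%:R) <= _); last first.
  apply: ler_sum => w _; have [hw|] := boolP [forall i, w i \in X i]; last first.
    rewrite negb_forall => /existsP[i hi].
    have -> : \prod_l chi l (w l) = 0 by rewrite (bigD1 i) //= /chi (negbTE hi) mul0r.
    rewrite big1 => [|? _]; last by rewrite mul0r.
    rewrite subrr mulr0; apply: prodr_ge0 => l _; by have := V0 l (w l) (w (ordS l)); rewrite mxE.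
  move/forallP in hw.
  have -> : \prod_l chi l (w l) = 1 by apply: big1 => l _; rewrite /chi hw.
  have [hb|] := boolP [exists i, bad i (w i) (w (ordS i))].
    have /existsP[i hi] := hb.
    apply: le_trans (_ : 0 <= _); last first.
      by apply: prodr_ge0 => l _; have := V0 l (w l) (w (ordS l)); rewrite mxE.
    apply: mulr_ge0_le0; first exact: exprn_ge0.
    rewrite (bigD1 i) //= hi mul1r subr_le0 lerDl.
    by apply: sumr_ge0 => l _; rewrite mul1r.
  rewrite negb_exists => /forallP hb.
  rewrite big1 => [|l _]; last by rewrite (negbTE (hb l)) mulr0.
  rewrite subr0 mulr1 -[X in a ^+ X](card_ord j.+1) -prodr_const.
  by apply: ler_prod => l _; rewrite a0 /= hgood.
rewrite -mulr_sumr sumrB -mulrA ler_wpM2l ?exprn_ge0 //.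
rewrite -bigA_distr_bigA (eq_bigr _ (fun i _ => chiE i)) -/N exchange_big /=.
have hi i : \sum_(w : {ffun 'I_j.+1 -> 'I_n})
    (\prod_l chi l (w l)) * (bad i (w i) (w (ordS i)))%:R <= N / (2 * j.+1%:R).
  have ii : ordS i != i.
    apply/eqP => /(congr1 val) /=; have := ltn_ord i; rewrite ltnS leq_eqVlt => /orP[/eqP ->|h].
      by rewrite modnn; lia.
    by rewrite modn_small //; lia.
  rewrite (sum_walk_pair chi (fun a b => (bad i a b)%:R) ii).
  have -> : N = #|X i|%:R * #|X (ordS i)|%:R * \prod_(l | (l != i) && (l != ordS i)) #|X l|%:R.
    by rewrite /N (bigD1 i) //= (bigD1 (ordS i)) //= mulrA.
  rewrite ler_pdivlMr ?mulr_gt0 ?ltr0n // (eq_bigr _ (fun l _ => chiE l)) mulrAC ler_wpM2r //.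
    by apply: prodr_ge0 => l _; apply: ltW.
  apply: le_trans (hbad i); rewrite mulr_suml [leRHS]big_mkcond /=.
  apply: ler_sum => x _; rewrite /chi mulr_suml; case: ifP => xX; last first.
    by rewrite big1 // => y _; rewrite !mul0r.
  rewrite [leRHS]big_mkcond /=; apply: ler_sum => y _.
  by case: ifP => yX; rewrite ?mulr0 ?mul0r // !mul1r.
have : \sum_(i < j.+1) \sum_(w : {ffun 'I_j.+1 -> 'I_n})
    (\prod_l chi l (w l)) * (bad i (w i) (w (ordS i)))%:R <= \sum_(i < j.+1) N / (2 * j.+1%:R).
  by apply: ler_sum => i _; apply: hi.
rewrite sumr_const card_ord -[X in _ <= X -> _]mulr_natr => h.
have e : N / (2 * j.+1%:R) * j.+1%:R = N / 2.
  by rewrite invfM -!mulrA mulVf ?mulr1 // pnatr_eq0.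
rewrite e in h; lra.
Qed.

(** Position [i] receives the points of its cell whose rank in the enumeration of the cell is [i]
    modulo [m], so positions sharing a cell get disjoint sets. The factor 2 pays for rounding down
    |cell| / m, which is at least 1. *)
Lemma disjoint_subcells m (c : 'I_n -> nat) (w : 'I_m -> 'I_n) :
  (forall i, m <= #|cell c (w i)|)%N ->
  exists X : 'I_m -> {set 'I_n}, [/\ forall i, X i \subset cell c (w i),
    forall i, (#|cell c (w i)| <= 2 * m * #|X i|)%N &
    forall i j x, x \in X i -> x \in X j -> i = j].
Proof.
move=> hm; pose e i := enum (cell c (w i)).
pose X i := [set x in cell c (w i) | (index x (e i) %% m == i)%N].
exists X; split.
- by move=> i; apply/subsetP => x; rewrite inE => /andP[].
- move=> i; have m0 : (0 < m)%N by apply: leq_ltn_trans (ltn_ord i).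
  pose q := (#|cell c (w i)| %/ m)%N.
  have qm : (q * m <= #|cell c (w i)|)%N by apply: leq_trunc_div.
  have bnd (s : 'I_q) : (s * m + i < size (e i))%N.
    rewrite -cardE; apply: leq_trans qm; have := ltn_ord i; have := ltn_ord s; nia.
  pose f (s : 'I_q) := nth (w i) (e i) (s * m + i).
  have fi s : index (f s) (e i) = (s * m + i)%N by rewrite /f index_uniq ?enum_uniq.
  have finj : injective f.
    move=> s s' /(congr1 (index^~ (e i))); rewrite !fi => /addIn /eqP.
    by rewrite eqn_pmul2r // => /eqP; apply: val_inj.
  have : (#|[set f s | s : 'I_q]| <= #|X i|)%N.
    apply: subset_leq_card; apply/subsetP => _ /imsetP[s _ ->]; rewrite inE fi.
    by rewrite modnMDl modn_small // eqxx andbT -[_ \in _]mem_enum; apply: mem_nth.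
  rewrite card_imset // card_ord => qX.
  have := divn_eq #|cell c (w i)| m; have := ltn_pmod #|cell c (w i)| m0.
  have : (0 < q)%N by rewrite divn_gt0.
  rewrite -/q; nia.
move=> i j x; rewrite !inE => /andP[/eqP xi /eqP hi] /andP[/eqP xj /eqP hj].
have wij : c (w i) = c (w j) by rewrite -xi.
by apply: val_inj; rewrite /= -hi -hj /e (cell_eq wij).
Qed.

End Walks.

(** * Restriction to sets, and bad pairs of cells *)

Section Localisation.
Variable R : realFieldType.

(** A weight constant on pairs of cells is fixed by [avgmx] on both sides, so in the trace the
    projections around [A] are absorbed by the weight. *)
Lemma sum_coarse n (A : 'M[R]_n) c (F : 'I_n -> 'I_n -> R) :
  (forall x x' y y', c x = c x' -> c y = c y' -> F x y = F x' y') ->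
  \sum_x \sum_y F x y * coarse c A x y = \sum_x \sum_y F x y * A x y.
Proof.
move=> hF; pose M : 'M[R]_n := \matrix_(x, y) F x y.
have tE (H : 'M[R]_n) : \sum_x \sum_y F x y * H x y = \tr (M^T *m H).
  rewrite exchange_big; apply: eq_bigr => y _; rewrite mxE; apply: eq_bigr => x _.
  by rewrite !mxE.
have WM : avgmx R c *m M = M.
  apply/matrixP => x y; rewrite mxE (@sum_avgmx_fix _ _ c x (fun z => M z y)) // => z zx.
  by rewrite !mxE; apply: hF.
have MW : M *m avgmx R c = M.
  apply/matrixP => x y; rewrite mxE.
  rewrite (eq_bigr (fun z => avgmx R c y z * M x z)) => [|z _]; last first.
    by rewrite mulrC -[in LHS]trmx_avgmx mxE.
  rewrite (@sum_avgmx_fix _ _ c y (fun z => M x z)) // => z zx.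
  by rewrite !mxE; apply: hF.
have MTW : M^T *m avgmx R c = M^T.
  by apply: trmx_inj; rewrite trmx_mul trmxK trmx_avgmx.
have WMT : avgmx R c *m M^T = M^T.
  by apply: trmx_inj; rewrite trmx_mul trmxK trmx_avgmx.
by rewrite !tE /coarse !mulmxA MTW mxtrace_mulC mulmxA WMT.
Qed.

(** Prescribing where each vertex of a walk lies is built into the matrices, so a trace still counts
    the walks. Cut bounds survive because a rectangle meets [X] times [Y] in a rectangle. *)
Definition restr n (A : 'M[R]_n) (X Y : {set 'I_n}) : 'M[R]_n :=
  \matrix_(x, y) (A x y * ((x \in X) && (y \in Y))%:R).

Lemma rect_restr n (A : 'M[R]_n) X Y S T :
  rect (restr A X Y) S T = rect A (S :&: X) (T :&: Y).
Proof.
rewrite /rect big_mkcond [RHS]big_mkcond; apply: eq_bigr => x _; rewrite inE.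
case: (x \in S) => //=; case xX: (x \in X); last first.
  by rewrite big1 // => y _; rewrite mxE xX mulr0.
rewrite big_mkcond [RHS]big_mkcond; apply: eq_bigr => y _; rewrite inE mxE xX /=.
by case: (y \in T) => //=; case: (y \in Y); rewrite ?mulr0 ?mulr1.
Qed.

Lemma restr_ge0 n (A : 'M[R]_n) X Y : lemx 0 A -> lemx 0 (restr A X Y).
Proof. by move=> A0 x y; have := A0 x y; rewrite !mxE => a0; rewrite mulr_ge0. Qed.

Lemma restr_le n (A : 'M[R]_n) X Y : lemx 0 A -> lemx (restr A X Y) A.
Proof.
move=> A0 x y; have := A0 x y; rewrite !mxE => a0.
by case: (_ && _); rewrite ?mulr1 ?mulr0.
Qed.

Lemma restr_lowcut n (A E : 'M[R]_n) X Y (t : R) :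
  (forall S T, - t <= rect (A - E) S T) ->
  forall S T, - t <= rect (restr A X Y - restr E X Y) S T.
Proof. by move=> h S T; rewrite rectB !rect_restr -rectB. Qed.

Section BadPairs.
Variables (n : nat) (A : 'M[R]_n) (c1 c2 : 'I_n -> nat) (eps gam : R).

Definition dev : 'M[R]_n := \matrix_(x, y) (coarse c2 A - coarse c1 A) x y ^+ 2.

Definition bad_pair : rel 'I_n := fun x y =>
  (coarse c1 A x y < eps / (2 * n%:R)) || (gam / n%:R ^+ 2 < coarse c1 dev x y).

Lemma bad_pair_sym : A^T = A -> symmetric bad_pair.
Proof.
move=> AT x y; rewrite /bad_pair.
have DT : dev^T = dev.
  apply/matrixP => a b; rewrite mxE [dev b a]mxE [dev a b]mxE; congr (_ ^+ 2).
  have <- : (coarse c2 A - coarse c1 A)^T = coarse c2 A - coarse c1 A.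
    by rewrite linearB /= !trmx_coarse.
  by rewrite [RHS]mxE linearB /= !trmx_coarse.
by rewrite -{1}(trmx_coarse c1 AT) mxE -{1}(trmx_coarse c1 DT) [in X in _ || X]mxE.
Qed.

Lemma bad_pair_cell x x' y y' : c1 x = c1 x' -> c1 y = c1 y' -> bad_pair x y = bad_pair x' y'.
Proof. by move=> hx hy; rewrite /bad_pair !coarseE (cell_eq hx) (cell_eq hy). Qed.

(** Badness is constant on pairs of cells, so [A] may be replaced by its average. Sparse pairs
    contribute at most n^2 * eps / (2n). On irregular pairs the average, at most 2 / n, is below (2n
    / gam) times the mean of [dev], whose total is at most eps gam / 4. Each kind contributes at
    most eps n / 2. *)
Lemma bad_pair_mass : (0 < n)%N -> 0 < eps -> 0 < gam -> lemx 0 A -> A^T = A -> refines c2 c1 ->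
  lemx (coarse c1 A) (const_mx (2 / n%:R)) ->
  energy c2 A <= energy c1 A + eps * gam / 4 ->
  \sum_x \sum_y (bad_pair x y)%:R * A x y <= eps * n%:R.
Proof.
move=> n0 e0 g0 A0 AT hr h2 hen; have nR : 0 < n%:R :> R by rewrite ltr0n.
rewrite -(@sum_coarse _ A c1 (fun x y => (bad_pair x y)%:R)); last first.
  by move=> x x' y y' hx hy; rewrite (bad_pair_cell hx hy).
have dev0 : lemx 0 dev by move=> x y; rewrite mxE [X in _ <= X]mxE sqr_ge0.
apply: le_trans (_ : \sum_(x < n) \sum_(y < n)
    (eps / (2 * n%:R) + 2 * n%:R / gam * coarse c1 dev x y) <= _).
  apply: ler_sum => x _; apply: ler_sum => y _.
  have a0 := coarse_ge0 c1 x y A0; have d0 := coarse_ge0 c1 x y dev0.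
  have p1 : 0 <= eps / (2 * n%:R) by rewrite divr_ge0 ?mulr_ge0 // ltW.
  have p2 : 0 < 2 * n%:R / gam by rewrite divr_gt0 ?mulr_gt0.
  have p3 := mulr_ge0 (ltW p2) d0.
  rewrite /bad_pair; case: ltP => ha /=; first by rewrite mul1r; lra.
  case: ltP => hd /=; last by rewrite mul0r addr_ge0.
  rewrite mul1r; have := h2 x y; rewrite [X in _ <= X -> _]mxE => h.
  have := ltW (_ : 2 * n%:R / gam * (gam / n%:R ^+ 2) < 2 * n%:R / gam * coarse c1 dev x y).
  rewrite ltr_pM2l // => /(_ hd).
  have -> : 2 * n%:R / gam * (gam / n%:R ^+ 2) = 2 / n%:R by field; rewrite !gt_eqF.
  lra.
have sd : \sum_x \sum_y coarse c1 dev x y <= eps * gam / 4.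
  have := @sum_coarse _ dev c1 (fun _ _ => 1) (fun _ _ _ _ _ _ => erefl).
  under eq_bigr do under eq_bigr do rewrite mul1r.
  move=> ->; under eq_bigr do under eq_bigr do rewrite mul1r mxE.
  rewrite energy_pythagoras //; lra.
under eq_bigr do rewrite big_split /= sumr_const card_ord -mulr_sumr.
rewrite big_split /= sumr_const card_ord -mulr_sumr.
have -> : eps * n%:R = eps / (2 * n%:R) *+ n *+ n + 2 * n%:R / gam * (eps * gam / 4).
  rewrite -[_ *+ n *+ n]mulr_natr -[_ *+ n]mulr_natr; field; rewrite !gt_eqF //.
by rewrite lerD2l ler_wpM2l // divr_ge0 ?mulr_ge0 // ltW.
Qed.

(* Chebyshev. *)
Lemma bad_pair_count (m : nat) (x y : 'I_n) (X Y : {set 'I_n}) :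
  (0 < n)%N -> 0 < eps -> gam = eps ^+ 2 / (128 * m%:R ^+ 3) -> (0 < m)%N -> lemx 0 A ->
  ~~ bad_pair x y -> X \subset cell c1 x -> Y \subset cell c1 y ->
  (#|cell c1 x| <= 2 * m * #|X|)%N -> (#|cell c1 y| <= 2 * m * #|Y|)%N ->
  \sum_(u in X) \sum_(v in Y) (coarse c2 A u v < eps / (4 * n%:R))%R%:R * (2 * m%:R)
    <= #|X|%:R * #|Y|%:R :> R.
Proof.
move=> n0 e0 gE m0 A0; rewrite negb_or -!leNgt => /andP[h1 h2] sX sY cX cY.
have nR : 0 < n%:R :> R by rewrite ltr0n.
have mR : 0 < m%:R :> R by rewrite ltr0n.
have aE u v : u \in X -> v \in Y -> coarse c1 A u v = coarse c1 A x y.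
  move=> /(subsetP sX) + /(subsetP sY); rewrite !inE => /eqP hu /eqP hv.
  by rewrite !coarseE (cell_eq hu) (cell_eq hv).
pose q := eps / (4 * n%:R); have q0 : 0 < q by rewrite divr_gt0 ?mulr_gt0.
have hdev : rect dev (cell c1 x) (cell c1 y) <=
    gam / n%:R ^+ 2 * (#|cell c1 x|%:R * #|cell c1 y|%:R).
  by move: h2; rewrite coarseE ler_pdivrMr ?mulr_gt0 ?card_cell_gt0.
(* The average over [c1] is at least 2q on this pair of cells, so a value of [coarse c2 A] below q
   deviates from it by at least q. *)
have i1 : \sum_(u in X) \sum_(v in Y) (coarse c2 A u v < q)%R%:R * q ^+ 2 <= rect dev (cell c1 x) (cell c1 y).
  apply: le_trans (_ : rect dev X Y <= _); last first.
    have dp u v : 0 <= dev u v by rewrite mxE sqr_ge0.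
    rewrite /rect [X in X <= _]big_mkcond [X in _ <= X]big_mkcond; apply: ler_sum => u _.
    case: ifP => uX; last by case: ifP => // _; apply: sumr_ge0.
    rewrite (subsetP sX) // [X in X <= _]big_mkcond [X in _ <= X]big_mkcond; apply: ler_sum => v _.
    by case: ifP => vY; [rewrite (subsetP sY) | case: ifP].
  apply: ler_sum => u uX; apply: ler_sum => v vY.
  have -> : dev u v = (coarse c2 A u v - coarse c1 A x y) ^+ 2.
    by rewrite -(aE u v) // mxE [X in X ^+ 2 = _]mxE [X in (_ + X) ^+ 2 = _]mxE.
  case: ltP => h; last by rewrite mul0r sqr_ge0.
  rewrite mul1r -[X in _ <= X]sqrrN; apply: lerXn2r; rewrite ?nnegrE ?(ltW q0) //.
    have : eps / (2 * n%:R) = q + q by rewrite /q; field; rewrite gt_eqF.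
    lra.
  have : eps / (2 * n%:R) = q + q by rewrite /q; field; rewrite gt_eqF.
  lra.
have i2 : #|cell c1 x|%:R * #|cell c1 y|%:R <= (2 * m%:R * #|X|%:R) * (2 * m%:R * #|Y|%:R) :> R.
  by apply: ler_pM => //; rewrite -!natrM ler_nat.
have i3 := le_trans i1 hdev.
have g0 : 0 <= gam / n%:R ^+ 2.
  by rewrite gE !divr_ge0 ?sqr_ge0 // mulr_ge0 ?exprn_ge0.
have i4 := le_trans i3 (ler_wpM2l g0 i2).
have q2 : 0 < q ^+ 2 by rewrite exprn_gt0.
rewrite -(ler_pM2r q2).
have -> : (\sum_(u in X) \sum_(v in Y) (coarse c2 A u v < eps / (4 * n%:R))%R%:R * (2 * m%:R)) * q ^+ 2
   = 2 * m%:R * \sum_(u in X) \sum_(v in Y) (coarse c2 A u v < q)%R%:R * q ^+ 2.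
  rewrite mulr_suml mulr_sumr; apply: eq_bigr => u _; rewrite mulr_suml mulr_sumr.
  by apply: eq_bigr => v _; rewrite /q; ring.
have mm : 0 <= 2 * m%:R :> R by rewrite mulr_ge0.
(* 2m from the union bound, (2m)^2 from passing to subcells and [q ^+ 2] = eps^2 / (16 n^2) combine
   into the 128 m^3 of [gam]. *)
apply: le_trans (ler_wpM2l mm i4) _; rewrite le_eqVlt; apply/orP; left; apply/eqP.
by rewrite gE /q; field; rewrite !gt_eqF.
Qed.

End BadPairs.
End Localisation.

(** * Removal lemma for matrices *)

Section Removal.
Variable R : archiRealFieldType.

(** The scale [b1] is known only once [A] is given, so all constants are functions of a relative
    cell size [b]. As [cc] is increasing on positive reals, [cc b'] serves for every [b1]. *)
Lemma removal_mx (k : nat) (eps B : R) : (0 < k)%N -> 0 < eps -> 0 <= B ->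
  exists (c0 t : R) (n0 : nat), [/\ 0 < c0, 0 < t, (0 < n0)%N &
    forall n (A : 'M[R]_n), (n0 <= n)%N -> spread A t ->
    \sum_x \sum_y (A ^+ k) x y ^+ 2 <= B ->
    exists bad : rel 'I_n, [/\ symmetric bad,
      \sum_x \sum_y (bad x y)%:R * A x y <= eps * n%:R &
      forall w : 'I_(2 * k).+1 -> 'I_n, (forall i, ~~ bad (w i) (w (ordS i))) ->
      exists X : 'I_(2 * k).+1 -> {set 'I_n},
        (forall i j x, x \in X i -> x \in X j -> i = j) /\
        c0 <= \tr (\prod_(0 <= i < (2 * k).+1) restr A (X (inord i)) (X (ordS (inord i))))]].
Proof.
move=> k0 e0 B0; set m := (2 * k).+1.
have mR : 0 < m%:R :> R by rewrite ltr0n.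
pose gam := eps ^+ 2 / (128 * m%:R ^+ 3).
have g0 : 0 < gam by rewrite divr_gt0 ?mulr_gt0 ?exprn_gt0.
(* Sets of size b n / (2m) and entries eps / (4n) give a trace of at least (eps b / (8m))^m / 2,
   which is [2 * cc b]. Half of it is reserved for the counting error. *)
pose cc (b : R) := (eps * b / (8 * m%:R)) ^+ m / 4.
have cc0 b : 0 < b -> 0 < cc b.
  by move=> b0; rewrite divr_gt0 // exprn_gt0 // divr_gt0 ?mulr_gt0.
pose B' := 2 * B + 2 * 64 ^+ k.
have B'0 : 0 < B' by rewrite ltr_wpDl ?mulr_ge0 ?mulr_gt0 ?exprn_gt0.
(* Makes the truncation error over all m replacements equal to [cc b / 2]; [kap] then holds the cut
   error to the other [cc b / 2]. *)
pose L b := 8 * m%:R * 4 ^+ k * B' / cc b.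
have L0 b : 0 < b -> 0 < L b.
  by move=> b0; rewrite divr_gt0 ?cc0 // !mulr_gt0 ?exprn_gt0.
pose kap b := Num.min 1 (cc b / (2 * m%:R * L b ^+ 2)).
have kap0 b : 0 < b -> 0 < kap b <= 1.
  move=> b0; rewrite lt_min ltr01 ge_min lexx /= andbT.
  apply: divr_gt0 (cc0 b b0) _; apply: mulr_gt0; [exact: mulr_gt0 | exact/exprn_gt0/L0].
have eg0 : 0 < eps * gam / 4 by apply: divr_gt0 (mulr_gt0 e0 g0) _.
have [b' [b'0 hb']] := strong_regularity kap0 eg0.
(* The bound on n makes every cell contain at least m points, as splitting it into m parts
   requires. *)
exists (cc b'), (b' ^+ 2), (Num.bound (m%:R / b')).+1; split=> //; [exact: cc0|exact: exprn_gt0|].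
move=> n A hn hA hB.
have n0 : (0 < n)%N by apply: leq_trans hn.
have nR : 0 < n%:R :> R by rewrite ltr0n.
have [A0 AT Arow _] := hA.
have [c1 [c2 [b1 [[b1b' big1 ref big2 hcut] hen]]]] := hb' n A _ n0 (lexx _) hA.
have b10 : 0 < b1 by apply: lt_le_trans b1b'.
have le1 : lemx (coarse c1 A) (const_mx (2 / n%:R)).
  by apply: (coarse_le n0 b10 _ hA big1); apply: lerXn2r => //; rewrite nnegrE ltW.
have le2 : lemx (coarse c2 A) (const_mx (2 / n%:R)) := coarse_le n0 b'0 (lexx _) hA big2.
exists (bad_pair A c1 c2 eps gam); split; first exact: bad_pair_sym.
  exact: bad_pair_mass.
move=> w hw.
have cellm i : (m <= #|cell c1 (w i)|)%N.
  rewrite -(ler_nat R); apply: le_trans (big1 (w i)).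
  apply: le_trans (_ : b' * n%:R <= _); last by rewrite ler_wpM2r // ltW.
  rewrite mulrC -ler_pdivrMr //; apply: ltW.
  apply: lt_le_trans (_ : (Num.bound (m%:R / b'))%:R <= _).
    by apply: archi_boundP; rewrite divr_ge0 // ltW.
  by rewrite ler_nat; apply: leq_trans hn.
have [X [Xs Xc Xd]] := disjoint_subcells cellm.
exists X; split=> //.
have Xlow i : b1 * n%:R / (2 * m%:R) <= #|X i|%:R.
  rewrite ler_pdivrMr ?mulr_gt0 //; apply: le_trans (big1 (w i)) _.
  by rewrite -!natrM ler_nat mulnC; apply: Xc.
have X0 i : 0 < #|X i|%:R :> R.
  by apply: lt_le_trans (Xlow i); rewrite divr_gt0 ?mulr_gt0.
pose U i := restr A (X (inord i)) (X (ordS (inord i))).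
pose V i := restr (coarse c2 A) (X (inord i)) (X (ordS (inord i))).
have E0 : lemx 0 (coarse c2 A) by move=> x y; rewrite mxE coarse_ge0.
have V0 i : lemx 0 (V i) by apply: restr_ge0.
have hV : 2 * cc b1 <= \tr (\prod_(0 <= i < m) V i).
  have q0 : 0 <= eps / (4 * n%:R) by rewrite divr_ge0 ?mulr_ge0 // ltW.
  have := @mxtrace_prod_ge R n (2 * k) V X
    (fun _ x y => coarse c2 A x y < eps / (4 * n%:R)) (eps / (4 * n%:R)).
  rewrite -/m => /(_ _ q0 V0 X0); rewrite muln_gt0 k0 => /(_ isT) h.
  apply: le_trans (h _ _).
  - apply: le_trans (_ : (eps / (4 * n%:R)) ^+ m * (b1 * n%:R / (2 * m%:R)) ^+ m / 2 <= _).
      rewrite /cc -exprMn le_eqVlt; apply/orP; left; apply/eqP.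
      have -> : eps / (4 * n%:R) * (b1 * n%:R / (2 * m%:R)) = eps * b1 / (8 * m%:R).
        by field; rewrite !gt_eqF.
      by field.
    rewrite ler_wpM2r ?invr_ge0 // ler_wpM2l ?exprn_ge0 //.
    rewrite -[X in _ ^+ X](card_ord m) -prodr_const; apply: ler_prod => i _.
    by rewrite Xlow divr_ge0 ?mulr_ge0 // ltW.
  - move=> i x y xX yX; rewrite -leNgt => hxy.
    by rewrite mxE inord_val xX yX mulr1.
  - by move=> i; apply: (bad_pair_count n0 e0 (erefl _) _ A0 (hw i)).
have cutUV i S T : - (kap b1 * n%:R) <= rect (U i - V i) S T.
  by apply: restr_lowcut; apply: hcut.
have Vle i : lemx (V i) (const_mx (2 / n%:R)).
  by move=> x y; apply: le_trans (le2 x y); apply: restr_le.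
have := mxtrace_prod_replace_ge n0 (L0 b1 b10) A0 AT Arow hB
  (fun i => restr_ge0 _ _ A0) (fun i => restr_le _ _ A0) V0 Vle cutUV.
rewrite -/m -/B'; apply: le_trans.
have h1 : m%:R * (L b1 ^+ 2 * kap b1) <= cc b1 / 2.
  apply: le_trans (_ : m%:R * (L b1 ^+ 2 * (cc b1 / (2 * m%:R * L b1 ^+ 2))) <= _).
    by rewrite ler_wpM2l ?(ltW mR) // ler_wpM2l ?sqr_ge0 // ge_min lexx orbT.
  rewrite le_eqVlt; apply/orP; left; apply/eqP; field.
  by rewrite !gt_eqF // ?L0.
have h2 : m%:R * (4 * 4 ^+ k * B' / L b1) = cc b1 / 2.
  have c10 := cc0 b1 b10; rewrite /L; move: (cc b1) c10 => z z0.
  have p4 : 0 < 4 ^+ k :> R by rewrite exprn_gt0.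
  by field; rewrite !gt_eqF.
have h3 : cc b' <= cc b1.
  rewrite ler_wpM2r ?invr_ge0 //; apply: lerXn2r; rewrite ?nnegrE.
  - by rewrite divr_ge0 ?mulr_ge0 // ltW.
  - by rewrite divr_ge0 ?mulr_ge0 // ltW.
  - by rewrite ler_wpM2r ?invr_ge0 ?mulr_ge0 ?(ltW mR) // ler_wpM2l // ltW.
rewrite mulrDr; lra.
Qed.

End Removal.

(** * Graphs *)

Section Schatten.
Local Open Scope sesquilinear_scope.
Variable R : realType.

Lemma exp_conj_diag (F : fieldType) n (P : 'M[F]_n) (d : 'rV[F]_n) k : P \in unitmx ->
  (invmx P *m diag_mx d *m P) ^+ k = invmx P *m diag_mx (\row_j d 0 j ^+ k) *m P.
Proof.
move=> Pu; elim: k => [|k IH].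
  have -> : \row_j d 0 j ^+ 0 = const_mx 1 by apply/rowP => j; rewrite !mxE expr0.
  by rewrite diag_const_mx mulmx1 mulVmx // expr0.
rewrite exprS IH -[LHS]/(_ *m _) -!mulmxA (mulmxA P) mulmxV // mul1mx.
rewrite (mulmxA (diag_mx d)) mulmx_diag; congr (_ *m (diag_mx _ *m _)).
by apply/rowP => j; rewrite !mxE exprS.
Qed.

(** By the spectral theorem, the trace of a power of M^* M is the sum of the powers of its
    eigenvalues, the squares of the singular values. *)
Lemma sum_singular_value_exp n (N : 'M[R]_n) k :
  \sum_j singular_value (map_mx (real_complex R) N) j ^+ (2 * k) = \tr ((N^T *m N) ^+ k).
Proof.
set M := map_mx (real_complex R) N; pose B := M ^t* *m M.
have MT : M ^t* = map_mx (real_complex R) N^T.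
  by apply/matrixP => i j; rewrite !mxE; apply: conjc_real.
have BE : B = map_mx (real_complex R) (N^T *m N) by rewrite /B MT map_mxM.
have Bh : B ^t* = B.
  rewrite BE; apply/matrixP => i j; rewrite !mxE.
  have -> : \sum_j0 N^T j j0 * N j0 i = \sum_j0 N^T i j0 * N j0 j.
    by apply: eq_bigr => l _; rewrite !mxE mulrC.
  exact: conjc_real.
have Bn : B \is normalmx by apply/normalmxP; rewrite Bh.
have /orthomx_spectralP := Bn; set P := spectralmx B; set d := spectral_diag B => BP.
have Pu : P \is unitarymx by apply: spectral_unitarymx.
have Pi : P \in unitmx by apply: unitarymx_unit.
have d0 j : 0 <= d 0 j.
  have dE : diag_mx d = (P *m M ^t*) *m (P *m M ^t*) ^t*.
    have -> : (P *m M ^t*) ^t* = M *m invmx P.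
      rewrite invmx_unitary // trmx_mul map_mxM /=; congr (_ *m _).
      by apply/matrixP => a b; rewrite !mxE conjCK.
    rewrite -!mulmxA (mulmxA _ M) -/B BP !mulmxA mulmxV // mul1mx -mulmxA mulmxV // mulmx1.
    by [].
  have -> : d 0 j = (diag_mx d) j j by rewrite mxE eqxx.
  rewrite dE mxE; apply: sumr_ge0 => l _; rewrite [X in _ * X]mxE [X in _ * _ X]mxE.
  exact: mul_conjC_ge0.
have dE j : d 0 j = (real_complex R) (complex.Re (d 0 j)).
  by rewrite RRe_real // ger0_real.
have r0 j : 0 <= complex.Re (d 0 j) by have := d0 j; rewrite dE ler0c.
apply: (@complexI R).
have -> : (real_complex R) (\tr ((N^T *m N) ^+ k)) = \tr (B ^+ k).
  rewrite BE -trace_map_mx; congr (\tr _).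
  elim: k => [|k IH]; first by rewrite !expr0 map_mx1.
  by rewrite !exprS map_mxM IH.
rewrite BP exp_conj_diag // mxtrace_mulC mulmxA mulmxV // mul1mx mxtrace_diag.
rewrite rmorph_sum; apply: eq_bigr => j _.
rewrite mxE [in RHS]dE /singular_value -/B -/d exprM sqr_sqrtr ?r0 //.
by rewrite rmorphXn.
Qed.

Lemma schatten_norm_trace (T : finType) (nu : T -> T -> R) (k : nat) (C : R) :
  (0 < k)%N ->
  schatten_norm (2 * k)%:R (fun x y => (nu x y)%:C) <= C ->
  \tr (((\matrix_(i < #|T|, j < #|T|) (nu (enum_val i) (enum_val j) / #|T|%:R))^T *m
        (\matrix_(i < #|T|, j < #|T|) (nu (enum_val i) (enum_val j) / #|T|%:R))) ^+ k)
    <= C ^+ (2 * k).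
Proof.
move=> k0; set N := \matrix_(i, j) _; rewrite /schatten_norm.
have -> : kernel_mx (fun x y => (nu x y)%:C) = map_mx (real_complex R) N.
  apply/matrixP => i j; rewrite !mxE rmorphM /= fmorphV; congr (_ / _).
  by rewrite rmorph_nat.
have s0 j : 0 <= singular_value (map_mx (real_complex R) N) j by apply: sqrtr_ge0.
rewrite (eq_bigr _ (fun j _ => powR_mulrn (2 * k) (s0 j))) sum_singular_value_exp => h.
have t0 : 0 <= \tr ((N^T *m N) ^+ k).
  by rewrite -sum_singular_value_exp; apply: sumr_ge0 => j _; apply: exprn_ge0.
have kR : (2 * k)%:R != 0 :> R by rewrite pnatr_eq0; lia.
rewrite -[X in X <= _](powRr1 t0) -(mulVf kR) powRrM powR_mulrn ?powR_ge0 //.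
by apply: lerXn2r; rewrite ?nnegrE ?powR_ge0 // (le_trans _ h) ?powR_ge0.
Qed.

Lemma cut_norm_sub1 (T : finType) (nu : T -> T -> R) (tau : R) (X Y : {set T}) :
  (0 < #|T|)%N ->
  cut_norm (fun x y => (nu x y - 1)%:C) <= tau ->
  \sum_(x in X) \sum_(y in Y) nu x y <= #|X|%:R * #|Y|%:R + tau * #|T|%:R ^+ 2.
Proof.
move=> T0 hcut; have n2 : 0 < #|T|%:R ^+ 2 :> R by rewrite exprn_gt0 // ltr0n.
have := le_trans (le_bigmax 0 (fun AB : {set T} * {set T} => complex.Re
  `| (#|T|%:R ^+ 2)^-1 * \sum_(x in AB.1) \sum_(y in AB.2) (nu x y - 1)%:C |) (X, Y)) hcut.
rewrite /=; set z := _ * _.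
have -> : z = ((#|T|%:R ^+ 2)^-1 * \sum_(x in X) \sum_(y in Y) (nu x y - 1))%:C.
  rewrite /z rmorphM /= fmorphV rmorphXn /= rmorph_nat; congr (_ * _).
  by rewrite rmorph_sum; apply: eq_bigr => x _; rewrite rmorph_sum.
set v := _ * _ => h.
have {h} : v <= tau.
  apply: le_trans h; apply: le_trans (ler_norm _) _.
  by rewrite /Normc.normc /= expr0n addr0 sqrtr_sqr.
rewrite /v ler_pdivrMl // mulrC.
have -> : \sum_(x in X) \sum_(y in Y) (nu x y - 1) =
    \sum_(x in X) \sum_(y in Y) nu x y - #|X|%:R * #|Y|%:R.
  under eq_bigr do rewrite sumrB sumr_const.
  by rewrite sumrB sumr_const -[_ *+ #|X|]mulr_natl.
by rewrite lerBlDl.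
Qed.

End Schatten.

(** * Vertices of large degree *)

Section Cleaning.
Variables (R : realFieldType) (n : nat).
Implicit Types A : 'M[R]_n.

Lemma spread_le A (t t' : R) : t <= t' -> spread A t -> spread A t'.
Proof.
move=> tt [A0 AT hr hA]; split=> // X Y; apply: le_trans (hA X Y) _.
by rewrite lerD2l ler_wpM2r.
Qed.

Lemma rect_le A (B : 'M[R]_n) X Y : lemx A B -> rect A X Y <= rect B X Y.
Proof. by move=> h; apply: ler_sum => x _; apply: ler_sum => y _; apply: h. Qed.

(** With [S] the rows of sum above 2, 2|S| is at most the mass of the rows in [S], itself at most
    |S| + t n. So |S| is at most t n and that mass at most 2 t n; columns double it. *)
Lemma clean_degrees A (t : R) : (0 < n)%N -> lemx 0 A -> A^T = A ->
  (forall X Y, rect A X Y <= #|X|%:R * #|Y|%:R / n%:R + t * n%:R) ->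
  exists S : {set 'I_n}, spread (restr A (~: S) (~: S)) t /\
    \sum_x \sum_y ((x \in S) || (y \in S))%:R * A x y <= 4 * t * n%:R.
Proof.
move=> n0 A0 AT hA; have nR : 0 < n%:R :> R by rewrite ltr0n.
have a0 x y : 0 <= A x y by have := A0 x y; rewrite mxE.
pose S := [set x | 2 < \sum_y A x y]; exists S; split.
  split=> [||x|X Y].
  - exact: restr_ge0.
  - apply/matrixP => x y; rewrite !mxE andbC; congr (_ * _).
    by rewrite -[in LHS]AT mxE.
  - case: (boolP (x \in S)) => xS.
      by rewrite big1 // => y _; rewrite mxE inE xS mulr0.
    apply: le_trans (_ : \sum_y A x y <= _); last by move: xS; rewrite inE -leNgt.
    by apply: ler_sum => y _; apply: restr_le.
  apply: le_trans (hA X Y); apply: rect_le; exact: restr_le.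
have sE : \sum_x \sum_y (x \in S)%:R * A x y = rect A S [set: 'I_n].
  rewrite /rect [RHS]big_mkcond; apply: eq_bigr => x _; rewrite -mulr_sumr.
  by case: ifP => _; rewrite ?mul0r // mul1r; apply: eq_bigl => y; rewrite inE.
have sE' : \sum_x \sum_y (y \in S)%:R * A x y = rect A S [set: 'I_n].
  rewrite -sE exchange_big; apply: eq_bigr => y _; apply: eq_bigr => x _.
  by rewrite -[in LHS]AT mxE.
have h1 : #|S|%:R * 2 <= rect A S [set: 'I_n].
  rewrite mulrC mulr_natr -sumr_const; apply: ler_sum => x; rewrite inE => /ltW hx.
  by rewrite (eq_bigl predT) // => y; rewrite inE.
have h2 := hA S [set: 'I_n]; rewrite cardsT card_ord mulfK ?gt_eqF // in h2.
apply: le_trans (_ : rect A S [set: 'I_n] + rect A S [set: 'I_n] <= _); last lra.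
rewrite -{1}sE -sE' -big_split; apply: ler_sum => x _ /=; rewrite -big_split; apply: ler_sum => y _ /=.
by case: (x \in S); case: (y \in S); rewrite ?mul1r ?mul0r ?addr0 ?add0r // lerDl.
Qed.

End Cleaning.

(** * Cycles and closed walks *)

Section Cycles.

Lemma ordS_neq m (i : 'I_m) : (1 < m)%N -> ordS i != i.
Proof.
move=> m1; apply/eqP => /(congr1 val) /=; have := ltn_ord i; rewrite leq_eqVlt => /orP[/eqP e|h].
  by rewrite e modnn; lia.
by rewrite modn_small //; lia.
Qed.

Lemma set2_inj (T : finType) (a b c d : T) : [set a; b] = [set c; d] ->
  (a = c /\ b = d) \/ (a = d /\ b = c).
Proof.
move=> /setP e; have := e a; have := e b; have := e c; have := e d.
rewrite !inE !eqxx /= ?orbT.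
move=> /orP [] /eqP h1 /orP [] /eqP h2 /esym/orP [] /eqP h3 /esym/orP [] /eqP h4; subst; auto.
Qed.

Lemma cycle_edge m (i : 'I_m) : (1 < m)%N -> [set i; ordS i] \in edges (Cycle m).
Proof.
move=> m1; apply/imsetP; exists (i, ordS i) => //=.
by rewrite inE /= /cycle_rel eqxx /= eq_sym ordS_neq.
Qed.

(** Injectivity is dropped on purpose: a closed walk, unlike a cycle, can be lengthened by two steps
    at will. *)
Lemma not_free_walk (G : sgraph) m : (1 < m)%N -> ~~ is_free (Cycle m) G ->
  exists f : 'I_m -> G, forall i, adj (f i) (f (ordS i)).
Proof.
move=> m1 /set0Pn[S]; rewrite inE => /andP[/andP[/subsetP sE _] /existsP[f]].
case/and3P=> _ _ /eqP fE; exists f => i.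
have : [set f i; f (ordS i)] \in edges G.
  apply: sE; rewrite -fE; apply/imsetP; exists [set i; ordS i]; first exact: cycle_edge.
  by rewrite imsetU1 imset_set1.
case/imsetP => -[a b]; rewrite inE /= => hab /set2_inj [] [-> ->] //.
by rewrite adj_sym.
Qed.

(* Go once around the short cycle, then back and forth along one edge. *)
Lemma odd_walk_extend (T : Type) (e : rel T) j k (f : 'I_(2 * j).+1 -> T) :
  symmetric e -> (0 < j <= k)%N -> (forall i, e (f i) (f (ordS i))) ->
  exists g : 'I_(2 * k).+1 -> T, forall i, e (g i) (g (ordS i)).
Proof.
move=> esym /andP[j0 jk] hf.
have [F [hF hF0]] : exists F : nat -> T,
    (forall i, (i < 2 * j)%N -> e (F i) (F i.+1)) /\ e (F (2 * j)%N) (F 0%N).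
  exists (fun i => f (inord i)); split=> [i ij|].
    have := hf (inord i); congr (e _ (f _)); apply: val_inj.
    by rewrite /= !inordK ?modn_small // ltnS // ltnW.
  have := hf (inord (2 * j)); congr (e _ (f _)); apply: val_inj.
  by rewrite /= !inordK ?modnn.
clear f hf.
(* Beyond 2j, odd positions are at [F 0] and even ones at [F 1]. Thus position 2j + 1 closes the
   short walk, and the last position 2k, being even, is adjacent to the start. *)
pose g (i : nat) : T := if (i <= 2 * j)%N then F i else if odd i then F 0%N else F 1%N.
exists (fun i => g i) => i /=; have := ltn_ord i; rewrite ltnS; move: (i : nat) => l {i} lk.
have e01 : e (F 0%N) (F 1%N) by apply: hF; rewrite muln_gt0.
have gle i : (i <= 2 * j)%N -> g i = F i by rewrite /g => ->.
have gge i : (2 * j < i)%N -> g i = if odd i then F 0%N else F 1%N by rewrite /g ltnNge; case: leqP.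
have odd2 i : odd (2 * i) = false by rewrite oddM.
move: lk; rewrite leq_eqVlt => /orP [/eqP ->|lk].
  rewrite modnn [g 0%N]gle //; have := jk; rewrite leq_eqVlt => /orP [/eqP <-|jk'].
    by rewrite gle.
  by rewrite gge ?odd2 1?esym // ltn_pmul2l.
rewrite modn_small ?ltnS //; have [lj|jl|lj] := ltngtP l (2 * j).
- by rewrite gle ?gle ?(ltnW lj) //; apply: hF.
- rewrite !gge //=; last exact: ltnW.
  by case: (odd l) => //=; rewrite esym.
- by rewrite lj gle // gge //= odd2.
Qed.

(** Disjointness makes a walk injective and recoverable from its vertex set: its vertex in position
    [i] is the only one in [X i]. Hence no copy is counted twice through rotations or
    reflections. *)
Lemma walks_le_copies (G : sgraph) m (X : 'I_m -> {set G}) : (2 < m)%N ->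
  (forall i j x, x \in X i -> x \in X j -> i = j) ->
  (#|[set w : {ffun 'I_m -> G} |
      [forall i, (w i \in X i) && adj (w i) (w (ordS i))]]| <= #|copies (Cycle m) G|)%N.
Proof.
move=> m2 hX; set W := [set w | _].
have hW (w : {ffun 'I_m -> G}) i : w \in W -> w i \in X i /\ adj (w i) (w (ordS i)).
  by rewrite inE => /forallP/(_ i)/andP.
pose F (w : {ffun 'I_m -> G}) :=
  (w @: [set: 'I_m], [set w @: (e : {set 'I_m}) | e in edges (Cycle m)]).
rewrite -(@card_in_imset _ _ F W); last first.
  move=> w w' hw hw' [eV _]; apply/ffunP => i.
  have : w i \in w' @: [set: 'I_m] by rewrite -eV imset_f.
  case/imsetP => j _ wj; have [wi _] := hW w i hw; have [w'j _] := hW w' j hw'.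
  by rewrite wj in wi *; rewrite (hX _ _ _ wi w'j).
apply: subset_leq_card; apply/subsetP => _ /imsetP[w hw ->]; rewrite inE /is_subgraph /=.
apply/andP; split; [apply/andP; split|].
- apply/subsetP => _ /imsetP[_ /imsetP[[a b] + ->] ->]; rewrite inE /= imsetU1 imset_set1.
  case/andP=> _ /orP [] /eqP h; apply/imsetP.
    by exists (w a, w b); rewrite // inE /= h; case: (hW w a hw).
  exists (w b, w a); last by rewrite /= setUC.
  by rewrite inE /= h; case: (hW w b hw).
- by apply/forallP => e; apply/implyP => /imsetP[e' _ ->]; apply: imsetS; apply: subsetT.
apply/existsP; exists w; rewrite !eqxx !andbT; apply/injectiveP => i j wij.
have [wi _] := hW w i hw; have [wj _] := hW w j hw.
by apply: hX wi _; rewrite wij.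
Qed.

End Cycles.

Lemma lemx_mul (R : realFieldType) n (P P' Q Q' : 'M[R]_n) :
  lemx 0 P -> lemx P P' -> lemx 0 Q -> lemx Q Q' ->
  lemx 0 (P *m Q) /\ lemx (P *m Q) (P' *m Q').
Proof.
have e0 (M : 'M[R]_n) x y : lemx 0 M -> 0 <= M x y by move/(_ x y); rewrite mxE.
move=> P0 PP' Q0 QQ'; split=> x y; rewrite [X in X <= _]mxE [X in _ <= X]mxE.
  by apply: sumr_ge0 => z _; apply: mulr_ge0; apply: e0.
by apply: ler_sum => z _; apply: ler_pM; rewrite ?e0.
Qed.

(** Since [A] is symmetric it lies below both [N] and its transpose, so [A *m A] lies below
    [N^T *m N], the matrix whose powers compute Schatten norms. *)
Lemma sum_sqr_exp_le_trace (R : realFieldType) n (A N : 'M[R]_n) k :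
  lemx 0 A -> A^T = A -> lemx A N ->
  \sum_x \sum_y (A ^+ k) x y ^+ 2 <= \tr ((N^T *m N) ^+ k).
Proof.
move=> A0 AT AN.
have e0 (M : 'M[R]_n) x y : lemx 0 M -> 0 <= M x y by move/(_ x y); rewrite mxE.
rewrite sum_sqr_trace; last by rewrite trmx_exp AT.
have -> : A ^+ k *m A ^+ k = (A *m A) ^+ k.
  by rewrite -[LHS]/(_ * _) -exprD addnn -mul2n exprM expr2.
have [|AA0 AAN] := @lemx_mul _ _ A N^T A N A0 _ A0 AN.
  by move=> x y; rewrite -{1}AT !mxE; apply: AN.
have NN0 : lemx 0 (N^T *m N) by move=> x y; apply: le_trans (AAN x y); apply: AA0.
have [|_] := @lemx_prod _ _ (nseq k (A *m A)) _ NN0.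
  by move=> M; rewrite mem_nseq => /andP[_ /eqP ->].
rewrite big_nseq -Monoid.iteropE size_nseq => h.
by apply: ler_sum => x _; apply: h.
Qed.

(** * The scaled adjacency matrix *)

Section Adjacency.
Variables (R : realType) (G : sgraph) (K p : R).
Hypotheses (K0 : 0 < K) (p0 : 0 < p) (G0 : (0 < #|G|)%N).

Definition adjmx : 'M[R]_#|G| :=
  \matrix_(i, j) ((adj (enum_val i) (enum_val j))%:R / (K * p * #|G|%:R)).

Lemma trmx_adjmx : adjmx^T = adjmx.
Proof. by apply/matrixP => i j; rewrite !mxE adj_sym. Qed.

Let d0 : 0 < K * p * #|G|%:R.
Proof. by rewrite !mulr_gt0 // ltr0n. Qed.

Lemma adjmx_ge0 : lemx 0 adjmx.
Proof. by move=> i j; rewrite !mxE divr_ge0 // ltW. Qed.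

Lemma adjmx_le (nu : G -> G -> R) : (forall x y : G, (adj x y)%:R <= K * p * nu x y) ->
  lemx adjmx (\matrix_(i < #|G|, j < #|G|) (nu (enum_val i) (enum_val j) / #|G|%:R)).
Proof.
move=> h i j; rewrite !mxE ler_pdivrMr //.
have -> : nu (enum_val i) (enum_val j) / #|G|%:R * (K * p * #|G|%:R) =
    K * p * nu (enum_val i) (enum_val j).
  by field; rewrite pnatr_eq0 -lt0n.
exact: h.
Qed.

Lemma rect_adjmx (nu : G -> G -> R) (tau : R) X Y :
  (forall x y : G, (adj x y)%:R <= K * p * nu x y) ->
  cut_norm (fun x y => (nu x y - 1)%:C) <= tau ->
  rect adjmx X Y <= #|X|%:R * #|Y|%:R / #|G|%:R + tau * #|G|%:R.
Proof.
move=> h hcut; have nR : 0 < #|G|%:R :> R by rewrite ltr0n.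
apply: le_trans (rect_le X Y (adjmx_le h)) _.
have := cut_norm_sub1 (enum_val @: X) (enum_val @: Y) G0 hcut.
rewrite !card_imset; try exact: enum_val_inj.
rewrite big_imset /=; last by move=> ? ? _ _; apply: enum_val_inj.
under eq_bigr => x _ do (rewrite big_imset /=; last by move=> ? ? _ _; apply: enum_val_inj).
move=> hs; rewrite /rect.
have -> : \sum_(x in X) \sum_(y in Y)
    (\matrix_(i < #|G|, j < #|G|) (nu (enum_val i) (enum_val j) / #|G|%:R)) x y
  = (\sum_(x in X) \sum_(y in Y) nu (enum_val x) (enum_val y)) / #|G|%:R.
  rewrite mulr_suml; apply: eq_bigr => x _; rewrite mulr_suml; apply: eq_bigr => y _.
  by rewrite mxE.
rewrite ler_pdivrMr //; apply: le_trans hs _.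
by rewrite le_eqVlt; apply/orP; left; apply/eqP; field; rewrite gt_eqF.
Qed.

(** After scaling, a walk contributes at most 1 to the trace, and nothing unless it follows edges
    with its vertices in the prescribed sets. *)
Lemma trace_restr_adjmx k (A : 'M[R]_#|G|) (X : 'I_(2 * k).+1 -> {set 'I_#|G|}) :
  (0 < k)%N -> lemx 0 A -> lemx A adjmx ->
  (forall i j x, x \in X i -> x \in X j -> i = j) ->
  \tr (\prod_(0 <= i < (2 * k).+1) restr A (X (inord i)) (X (ordS (inord i))))
    * (K * p * #|G|%:R) ^+ (2 * k).+1 <= #|copies (Cycle (2 * k).+1) G|%:R.
Proof.
move=> k0 A0 AA hX; set m := (2 * k).+1; pose d := K * p * #|G|%:R.
pose W := [set w : {ffun 'I_m -> 'I_#|G|} |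
  [forall i, (w i \in X i) && adj (enum_val (w i)) (enum_val (w (ordS i)))]].
apply: le_trans (_ : #|W|%:R <= _).
  rewrite mxtrace_prod mulr_suml -sum1_card natr_sum [X in _ <= X]big_mkcond.
  apply: ler_sum => w _; rewrite -/m -/d.
  rewrite -[X in d ^+ X](card_ord m) -prodr_const -big_split /=.
  have fac0 (i : 'I_m) : 0 <= restr A (X (inord i)) (X (ordS (inord i))) (w i) (w (ordS i)) * d.
    have := restr_ge0 (X (inord i)) (X (ordS (inord i))) A0 (w i) (w (ordS i)).
    by rewrite [X in X <= _]mxE => r0; rewrite mulr_ge0 // ltW.
  have fac1 (i : 'I_m) : restr A (X (inord i)) (X (ordS (inord i))) (w i) (w (ordS i)) * d <=
      ((w i \in X i) && adj (enum_val (w i)) (enum_val (w (ordS i))))%:R.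
    rewrite mxE inord_val; case wi : (w i \in X i); last by rewrite mulr0 mul0r.
    apply: le_trans (_ : A (w i) (w (ordS i)) * d <= _).
      have := A0 (w i) (w (ordS i)); rewrite mxE => a0; rewrite ler_wpM2r ?(ltW d0) //.
      by case: (_ \in _); rewrite ?mulr1 ?mulr0.
    by have := AA (w i) (w (ordS i)); rewrite [X in _ <= X -> _]mxE ler_pdivlMr.
  rewrite inE; case: ifPn => [_|].
    apply: le_trans (_ : \prod_(i < m) (1 : R) <= _); last by rewrite big1.
    by apply: ler_prod => i _; rewrite fac0 /=; apply: le_trans (fac1 i) _; case: (_ && _).
  rewrite negb_forall => /existsP[i hi]; rewrite (bigD1 i) //=.
  have -> : restr A (X (inord i)) (X (ordS (inord i))) (w i) (w (ordS i)) * d = 0.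
    apply/eqP; rewrite eq_le fac0 andbT; apply: le_trans (fac1 i) _.
    by rewrite (negbTE hi).
  by rewrite mul0r.
pose X' i := enum_val @: X i : {set G}.
have hX' i j x : x \in X' i -> x \in X' j -> i = j.
  move=> /imsetP[a ai ->] /imsetP[b bj] /enum_val_inj ab; apply: hX ai _.
  by rewrite ab.
rewrite ler_nat; apply: leq_trans (walks_le_copies (m := m) _ hX'); last by rewrite /m; lia.
pose F (w : {ffun 'I_m -> 'I_#|G|}) : {ffun 'I_m -> G} := [ffun i => enum_val (w i)].
rewrite -(@card_imset _ _ F W); last first.
  move=> w w' /ffunP h; apply/ffunP => i; have := h i; rewrite !ffunE.
  exact: enum_val_inj.
apply: subset_leq_card; apply/subsetP => _ /imsetP[w + ->]; rewrite !inE => /forallP hw.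
apply/forallP => i; rewrite !ffunE; have /andP[wi ->] := hw i.
by rewrite andbT imset_f.
Qed.

Lemma card_bad_edges (Bad : rel 'I_#|G|) (D : {set {set G}}) :
  D = [set [set enum_val u.1; enum_val u.2] |
        u : 'I_#|G| * 'I_#|G| & adj (enum_val u.1) (enum_val u.2) && Bad u.1 u.2] ->
  #|D|%:R <= K * p * #|G|%:R * \sum_x \sum_y (Bad x y)%:R * adjmx x y.
Proof.
move=> ->; set P := [set u | _].
apply: le_trans (_ : #|P|%:R <= _); first by rewrite ler_nat leq_imset_card.
rewrite -sum1_card natr_sum mulr_sumr big_mkcond /=.
under [X in _ <= X]eq_bigr do rewrite mulr_sumr.
rewrite [X in _ <= X]pair_big /=; apply: ler_sum => -[x y] _ /=.
rewrite inE /= mxE; case: (adj _ _); case: (Bad x y) => //=; rewrite ?mul0r ?mulr0 //.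
by rewrite mul1r mul1r mulfV // gt_eqF.
Qed.

End Adjacency.

Theorem corollary1p4 (R : realType) (k : nat) (hk : (2 <= k)%N)
    (eps K C : R) (heps : 0 < eps) (hK : 0 < K) (hC : 0 < C) :
  exists (n0 : nat) (delta tau : R),
    [/\ (0 < n0)%N, 0 < delta & 0 < tau] /\
    forall (n : nat) (p : R) (G : sgraph) (nu : G -> G -> R),
      (n0 <= n)%N -> 0 < p -> #|G| = n ->
      (forall x y : G, 0 <= nu x y) ->
      (forall x y : G, (adj x y)%:R <= K * p * nu x y) ->
      schatten_norm (2 * k)%:R (fun x y => (nu x y)%:C) <= C ->
      cut_norm (fun x y => (nu x y - 1)%:C) <= tau ->
      #|copies (Cycle (2 * k + 1)) G|%:R
        <= delta * p ^+ (2 * k + 1) * n%:R ^+ (2 * k + 1) ->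
      exists D : {set {set G}},
        [/\ D \subset edges G,
            #|D|%:R <= eps * p * n%:R ^+ 2 &
            forall j : nat, (1 <= j <= k)%N ->
              is_free (Cycle (2 * j + 1)) (del_edges D)].
Proof.
have k0 : (0 < k)%N by apply: leq_trans hk.
have eK : 0 < eps / (2 * K) by rewrite divr_gt0 ?mulr_gt0.
have B0 : 0 <= C ^+ (2 * k) by apply/exprn_ge0/ltW.
have [c0 [t [n0 [c00 t0 n00 hrem]]]] := removal_mx k0 eK B0.
(* At eps / (8K) the cleaning costs at most eps / (2K) n in mass, and [removal_mx] was given the
   same budget; K p n times the total is eps p n^2. *)
pose tau := Num.min t (eps / (8 * K)).
have tau0 : 0 < tau by rewrite lt_min t0 divr_gt0 ?mulr_gt0.
(* The surviving walk forces c0 (K p n)^(2k+1) copies; the factor 1/2 makes the contradiction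
   strict. *)
exists n0, (K ^+ (2 * k + 1) * c0 / 2), tau; split.
  by split=> //; rewrite divr_gt0 // mulr_gt0 ?exprn_gt0.
move=> n p G nu n0n p0 Gn _ hadj hsch hcut hcop; subst n.
have G0 : (0 < #|G|)%N by apply: leq_trans n0n.
have nR : 0 < #|G|%:R :> R by rewrite ltr0n.
have A00 : lemx 0 (adjmx G K p) by apply: adjmx_ge0.
have A0T : (adjmx G K p)^T = adjmx G K p by apply: trmx_adjmx.
have [S [hS hSm]] := clean_degrees G0 A00 A0T (fun X Y => rect_adjmx hK p0 G0 X Y hadj hcut).
set A := restr _ _ _ in hS.
have [A0 AT _ _] := hS.
have AA : lemx A (adjmx G K p) by apply: restr_le.
have hB : \sum_x \sum_y (A ^+ k) x y ^+ 2 <= C ^+ (2 * k).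
  apply: le_trans (schatten_norm_trace k0 hsch); apply: sum_sqr_exp_le_trace => // i j.
  by apply: le_trans (AA i j) _; apply: adjmx_le.
have [|bad [bsym bmass bwalk]] := hrem _ A n0n _ hB.
  by apply: spread_le hS; rewrite ge_min lexx.
pose Bad : rel 'I_#|G| := fun x y => [|| x \in S, y \in S | bad x y].
pose D : {set {set G}} := [set [set enum_val u.1; enum_val u.2] |
  u : 'I_#|G| * 'I_#|G| & adj (enum_val u.1) (enum_val u.2) && Bad u.1 u.2].
exists D; split.
- apply/subsetP => _ /imsetP[[x y] + ->]; rewrite inE /= => /andP[hxy _].
  by apply/imsetP; exists (enum_val x, enum_val y); rewrite // inE.
- apply: le_trans (card_bad_edges hK p0 G0 (erefl D)) _.
  have -> : eps * p * #|G|%:R ^+ 2 = K * p * #|G|%:R * (eps / K * #|G|%:R).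
    by field; rewrite gt_eqF.
  rewrite ler_wpM2l //; first by rewrite !mulr_ge0 // ltW.
  (* Off [S] the matrix [A] is the adjacency matrix, so each removed pair is charged either to the
     cleaning or to the mass of [bad] in [A]. *)
  apply: le_trans (_ : \sum_x \sum_y (((x \in S) || (y \in S))%:R * adjmx G K p x y
      + (bad x y)%:R * A x y) <= _).
    apply: ler_sum => x _; apply: ler_sum => y _; rewrite /Bad /A [restr _ _ _ x y]mxE !inE.
    have := A00 x y; rewrite mxE; move: (adjmx G K p x y) => a a0.
    by case: (x \in S); case: (y \in S); case: (bad x y) => /=;
      rewrite ?mulr1 ?mulr0 ?mul1r ?mul0r ?addr0 ?add0r.
  under eq_bigr do rewrite big_split /=.
  rewrite big_split /=; apply: le_trans (lerD hSm bmass) _.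
  have ht : tau <= eps / (8 * K) by rewrite ge_min lexx orbT.
  have := ler_wpM2r (ltW nR) ht.
  have e1 : eps / (8 * K) * #|G|%:R = eps / K * #|G|%:R / 8 by field; rewrite gt_eqF.
  have e2 : eps / (2 * K) * #|G|%:R = eps / K * #|G|%:R / 2 by field; rewrite gt_eqF.
  rewrite e1 e2; lra.
move=> j /andP[j0 jk]; apply/negPn/negP; rewrite addn1 => hfree.
have m1 : (1 < (2 * j).+1)%N by rewrite ltnS muln_gt0.
have [f hf] := not_free_walk m1 hfree.
have [|g hg] := @odd_walk_extend _ (del_rel D) j k f (@del_rel_sym G D) _ hf.
  by rewrite j0.
have [|X [hX hc]] := bwalk (fun i => enum_rank (g i)).
  move=> i; apply/negP => hb; have /andP[gadj /negP] := hg i; apply.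
  apply/imsetP; exists (enum_rank (g i), enum_rank (g (ordS i))); last by rewrite /= !enum_rankK.
  by rewrite inE /= !enum_rankK gadj /Bad hb !orbT.
have := trace_restr_adjmx hK p0 G0 k0 A0 AA hX.
have d0 : 0 < (K * p * #|G|%:R) ^+ (2 * k).+1 by rewrite exprn_gt0 // !mulr_gt0.
rewrite !addn1 in hcop => /le_trans/(_ hcop).
apply/negP; rewrite -ltNge.
apply: lt_le_trans (ler_wpM2r (ltW d0) hc).
have -> : K ^+ (2 * k).+1 * c0 / 2 * p ^+ (2 * k).+1 * #|G|%:R ^+ (2 * k).+1 =
    c0 / 2 * (K * p * #|G|%:R) ^+ (2 * k).+1 by rewrite !exprMn; ring.
rewrite ltr_pM2r //; lra.
Qed.
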